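(* Let $\kappa\in\mathbb Z_+$, and let $X=X_{1,\kappa}$ and $\phi=\phi_{1,\kappa}$ be the set and self-map described in the context. Then there exists a discrete measure $\mu$ on $X$ such that the composition operator $C_\phi$ in $L^2(\mu)$ has the property that $\mathcal D^\infty(C_\phi)$ is dense in $L^2(\mu)$ and the following conditions hold: (i) $\{\mathsf h_{\phi^n}(x_\kappa)\}_{n=0}^\infty$ is an H-determinate Stieltjes moment sequence with index of H-determinacy at $0$ equal to $0$, (ii) for every $j\in\mathbb N$, $\{\mathsf h_{\phi^n}(x_{1,j})\}_{n=0}^\infty$ is an S-indeterminate Stieltjes moment sequence; in particular, $\{\mathsf h_{\phi^n}(x_{1,1})\}_{n=0}^\infty$ is a Stieltjes moment sequence, (iii) there exists a Borel probability measure $P(x_{1,1},\cdot)$ on $\mathbb R_+$ that satisfies the following three conditions: (i-b) $P(x_{1,1},\cdot)$ is an S-representing measure of $\{\mathsf h_{\phi^n}(x_{1,1})\}_{n=0}^\infty$ vanishing on $[0,1]$, (i-c) $\frac{\mu(x_{1,1})}{\mu(x_r)}\int_0^\infty\frac{t^r-1}{t^{\kappa+1}-1}P(x_{1,1},dt)+\frac{\mu(x_0)}{\mu(x_r)}=1$ for every $r\in J_\kappa$, (i-d$'$) $\mu(x_{1,1})\int_0^\infty\frac1{t^{\kappa+1}-1}P(x_{1,1},dt)<\infty$, and does not satisfy the condition (i-d) $\frac{\mu(x_{1,1})}{\mu(x_0)}\int_0^\infty\frac1{t^{\kappa+1}-1}P(x_{1,1},dt)\le1$, (iv) if $\kappa=0$,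 then there exists a family $\{P'(x,\cdot)\}_{x\in X}$ of Borel probability measures on $\mathbb R_+$ that satisfies the consistency condition (CC) and, consequently, $C_\phi$ is subnormal.
   Context: Notation: $\mathbb N=\{1,2,\ldots\}$, $\mathbb Z_+=\{0,1,2,\ldots\}$, $\mathbb R_+=[0,\infty)$, $J_k=\{i\in\mathbb N:i\le k\}$ ($J_0=\emptyset$); $0^0=1$; $\int_0^\infty$ means $\int_{[0,\infty)}$. All measures are positive. Integrals with denominator $t^{\kappa+1}-1$ are taken with respect to measures vanishing on $[0,1]$, i.e. effectively over $(1,\infty)$. The set and the symbol. $X=X_{1,\kappa}=\{x_0,\ldots,x_\kappa\}\cup\{x_{1,j}:j\in\mathbb N\}$, all listed points being distinct, and $\phi=\phi_{1,\kappa}\colon X\to X$ is given by $\phi(x_{1,j})=x_{1,j-1}$ for $j\ge2$; $\phi(x_{1,1})=x_\kappa$; $\phi(x_0)=x_\kappa$; $\phi(x_r)=x_{r-1}$ for $r\in J_\kappa$. Operators. A discrete measure on a nonempty set $X$ is a $\sigma$-finite measure $\mu$ on $2^X$ with $\mu(x):=\mu(\{x\})>0$ for all $x\in X$ (so $\mu(x)<\infty$ as well). The composition operator $C_\phi$ in $L^2(\mu)$ has domain $\{f\in L^2(\mu):f\circ\phi\in L^2(\mu)\}$ and $C_\phi f=f\circ\phi$. For $n\in\mathbb Z_+$, $\mathsf h_{\phi^n}(x)=\mu((\phi^n)^{-1}(\{x\}))/\mu(x)\in[0,\infty]$. $\mathcal D^\infty(A)=\bigcap_{n\ge0}\mathcal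 D(A^n)$. An operator $A$ in a complex Hilbert space $\mathcal H$ is subnormal if it is densely defined and there is a (possibly unbounded) normal operator $N$ in a complex Hilbert space $\mathcal K\supseteq\mathcal H$ (isometric embedding) with $\mathcal D(A)\subseteq\mathcal D(N)$ and $Af=Nf$ for $f\in\mathcal D(A)$. Consistency condition. A family $\{P(x,\cdot)\}_{x\in X}$ of Borel probability measures on $\mathbb R_+$ satisfies (CC) if $\frac1{\mu(x)}\sum_{y\in\phi^{-1}(\{x\})}\mu(y)P(y,\sigma)=\int_\sigma t\,P(x,dt)$ for every Borel $\sigma\subseteq\mathbb R_+$ and every $x\in\phi(X)$. Moments. Let $\mathscr M$ be the set of Borel measures $\nu$ on $\mathbb R$ with $\int|t|^n\,d\nu<\infty$ for all $n\in\mathbb Z_+$, and $\mathscr M^+$ the set of those $\nu\in\mathscr M$ with closed support in $\mathbb R_+$ (Borel measures on $\mathbb R_+$ are identified with Borel measures on $\mathbb R$ supported in $\mathbb R_+$). A real sequence $\{\gamma_n\}_{n=0}^\infty$ is a Hamburger (resp. Stieltjes) moment sequence if there is $\nu\in\mathscr M$ (resp. $\mathscr M^+$) with $\gamma_n=\int t^n\,d\nu(t)$ for all $n\in\mathbb Z_+$; such $\nu$ are its H-representing (resp. S-representing) measures. A Hamburger (resp. Stieltjes) moment sequence is H-determinate (resp. S-determinate) if it has exactly one H-representing (resp. S-representing) measure, and otherwise H-indeterminate (resp. S-indeterminate); a measure in $\mathscr M$ is H-determinate if its moment sequence is. The index of H-determinacy of an H-determinate measure $\rho$ at $z\in\mathbb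 C$ is $\mathrm{ind}_z(\rho)=\sup\{k\in\mathbb Z_+:|t-z|^{2k}d\rho(t)\text{ is H-determinate}\}$; the index of an H-determinate moment sequence is that of its unique H-representing measure. *)

(* Defs.v *)
From HB Require Import structures.
From mathcomp Require Import all_boot all_order all_algebra.
From mathcomp Require Import sesquilinear complex.
From mathcomp Require Import all_classical all_reals all_analysis measurable_realfun.
From mathcomp Require Import ring lra.
Set Implicit Arguments.
Unset Strict Implicit.
Unset Printing Implicit Defensive.
Import Order.TTheory GRing.Theory Num.Theory.
Import numFieldNormedType.Exports.
Local Open Scope classical_set_scope.
Local Open Scope ring_scope.
Local Open Scope complex_scope.

(* A complex Hilbert space is a complete normed R[i]-module whose norm comes
   from an inner product, linear in its first argument.  As for every normed
   R[i]-module of the library, the norm takes its (real) values in R[i]. *)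
HB.mixin Record isHilbert (R : realType) (V : Type)
    of CompleteNormedModule R[i] V := {
  inner : {dot V for (@Num.Def.conjC R[i])};
  normr_inner : forall x : V, `|x| ^+ 2 = inner x x
}.

#[short(type="hilbertType")]
HB.structure Definition Hilbert (R : realType) :=
  {V of CompleteNormedModule R[i] V & isHilbert R V}.

Section dot_norm.
Variables (R : realType) (V : lmodType R[i]).
Variable (dot : {dot V for (@Num.Def.conjC R[i])}).
Local Notation "''[' u , v ]" := (dot u v).
Local Notation "''[' u ]" := (dot u u).

Lemma dot_cauchy_schwarz u v : `|'[u, v]| ^+ 2 <= '[u] * '[v].
Proof.
have [-> | nz_v] := eqVneq v 0.
  by rewrite !linear0r normr0 expr0n.
have vv0 : '[v] != 0 by rewrite dnorm_eq0.
pose a := '[u, v] / '[v]; pose u1 := u - a *: v.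
have ou : '[u1, v] = 0.
  by rewrite linearBl/= linearZl_LR divfK ?subrr.
rewrite (canRL (subrK _) (erefl u1)) linearDl/= ou add0r.
rewrite linearZl_LR/= normrM (ger0_norm (dnorm_ge0 _ _)) exprMn.
rewrite hnormDd/=; last by rewrite linearZr_LR/= ou mulr0.
rewrite dnormZ mulrDl expr2 mulrA -[leLHS]add0r lerD2r.
by rewrite mulr_ge0 ?dnorm_ge0.
Qed.

Lemma dot_triangle u v :
  sqrtC '[u + v] <= sqrtC '[u] + sqrtC '[v].
Proof.
rewrite -(@ler_pXn2r _ 2)//= ?nnegrE ?addr_ge0 ?sqrtC_ge0 ?dnorm_ge0//.
rewrite sqrrD !sqrtCK dnormD/= addrAC lerD2r lerD2l.
set d := '[u, v].
have -> : d + d^*%R = 2 * 'Re d by rewrite ReE mulrC divfK ?pnatr_eq0.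
rewrite -[leRHS]mulr_natl ler_pM2l ?ltr0n//.
apply: (@le_trans _ _ `|d|).
  exact: (le_trans (real_ler_norm (Creal_Re d)) (leif_normC_Re_Creal _).1).
rewrite -(@ler_pXn2r _ 2)//= ?nnegrE ?mulr_ge0 ?sqrtC_ge0 ?dnorm_ge0//.
by rewrite exprMn !sqrtCK dot_cauchy_schwarz.
Qed.

Lemma dot_normZ (l : R[i]) (x : V) : sqrtC '[l *: x] = `|l| * sqrtC '[x].
Proof.
by rewrite dnormZ sqrtCM ?nnegrE ?exprn_ge0 ?dnorm_ge0// sqrCK.
Qed.

Lemma dot_norm0_eq0 (x : V) : sqrtC '[x] = 0 -> x = 0.
Proof. by move/eqP; rewrite sqrtC_eq0 dnorm_eq0 => /eqP. Qed.

End dot_norm.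

Lemma gt0_complexP (R : realType) (e : R[i]) :
  0 < e -> exists2 r : R, 0 < r & e = r%:C.
Proof.
case: e => a b; rewrite ltcE/= => /andP[/eqP -> a0]; by exists a.
Qed.

(* Builds a Hilbert space from an inner product on a bare module, with
   completeness stated for Cauchy sequences. *)
HB.factory Record Lmodule_isHilbert (R : realType) (V : Type)
    of GRing.Lmodule R[i] V := {
  dot : {dot V for (@Num.Def.conjC R[i])};
  dot_complete : forall u : nat -> V,
    (forall e : R, 0 < e -> exists N, forall m n, (N <= m)%N -> (N <= n)%N ->
      dot (u m - u n) (u m - u n) <= e%:C) ->
    exists l, forall e : R, 0 < e -> exists N, forall n, (N <= n)%N ->
      dot (u n - l) (u n - l) <= e%:C
}.

HB.builders Context R V of Lmodule_isHilbert R V.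

HB.instance Definition _ := Lmodule_isNormed.Build R[i] V
  (dot_triangle dot) (dot_normZ dot) (@dot_norm0_eq0 R V dot).

Let normr_dot (x : V) : `|x| ^+ 2 = dot x x.
Proof. exact: sqrtCK. Qed.

Let normr_dot_le (x : V) (r : R) : 0 <= r ->
  (`|x| <= r%:C) = (dot x x <= (r ^+ 2)%:C).
Proof.
move=> r0; rewrite -normr_dot rmorphXn/= ler_pXn2r// nnegrE; last by rewrite ler0c.
exact: normr_ge0.
Qed.

Let small (r : R) : 0 < r -> exists N, forall n, (N <= n)%N -> n.+1%:R^-1 <= r.
Proof.
move=> r0; exists (Num.trunc r^-1) => n Nn.
rewrite invf_ple ?posrE ?ltr0n//.
apply: (le_trans (ltW (truncnS_gt _))).
by rewrite ler_nat.
Qed.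

Let complete (F : set_system V) : ProperFilter F -> cauchy F -> cvg F.
Proof.
move=> FF Fc.
have ball_ex n : exists x : V, F (ball x (n.+1%:R^-1 : R)%:C).
  by apply: ((cauchyP F).1 Fc); rewrite ltcR invr_gt0 ltr0n.
have [u Fu] := choice ball_ex.
have ball_dist (x y : V) (r : R) : ball x r%:C y -> `|x - y| < r%:C.
  by rewrite -ball_normE.
have [|l ul] := @dot_complete u.
  move=> e e0.
  have [N smallN] : exists N, forall n, (N <= n)%N ->
      n.+1%:R^-1 <= Num.sqrt e / 2.
    by apply: small; rewrite divr_gt0 ?sqrtr_gt0.
  exists N => m n Nm Nn.
  have -> : e%:C = (Num.sqrt e ^+ 2)%:C by rewrite sqr_sqrtr ?ltW.
  rewrite -normr_dot_le ?sqrtr_ge0//.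
  have [y [/ball_dist ym /ball_dist yn]] := @filter_ex _ _ FF _ (filterI (Fu m) (Fu n)).
  rewrite -(subrKA y); apply: (le_trans (ler_normD _ _)).
  have -> : (Num.sqrt e)%:C = (Num.sqrt e / 2)%:C + (Num.sqrt e / 2)%:C.
    by rewrite -rmorphD/= -splitr.
  apply: lerD; last rewrite distrC.
    by apply: (le_trans (ltW ym)); rewrite lecR smallN.
  by apply: (le_trans (ltW yn)); rewrite lecR smallN.
apply/cvg_ex; exists l; apply/fcvg_ballP => _ /gt0_complexP[r r0 ->].
have r20 : 0 < r / 2 by rewrite divr_gt0.
have [N1 ulN] := ul _ (exprn_gt0 2 r20).
have [N2 smallN] := small r20.
pose n := maxn N1 N2.
apply: filterS (Fu n) => y /ball_dist yn.
rewrite -ball_normE/=.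
have -> : r%:C = (r / 2)%:C + (r / 2)%:C by rewrite -rmorphD/= -splitr.
rewrite -(subrKA (u n)); apply: (le_lt_trans (ler_normD _ _)).
rewrite addrC; apply: ltr_leD; last first.
  by rewrite distrC normr_dot_le ?(ltW r20)// ulN// leq_maxl.
by apply: (lt_le_trans yn); rewrite lecR smallN// leq_maxr.
Qed.

HB.instance Definition _ := Uniform_isComplete.Build V complete.
HB.instance Definition _ := isHilbert.Build R V normr_dot.

HB.end.

(* T with the sigma-algebra of all its subsets. *)
Definition powerset_space (T : Type) : Type := T.

HB.instance Definition _ (T : pointedType) := Pointed.on (powerset_space T).
HB.instance Definition _ (T : pointedType) :=
  @isMeasurable.Build default_measure_display (powerset_space T)
    discrete_measurable discrete_measurable0
    discrete_measurableC discrete_measurableU.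

Record discreteMeasure (T : pointedType) (R : realType) := DiscreteMeasure {
  discrete_measure :> {measure set (powerset_space T) -> \bar R};
  discrete_sigma_finite : sigma_finite [set: powerset_space T] discrete_measure;
  discrete_gt0 : forall x : T, (0 < discrete_measure [set x])%E
}.

(* The modulus as an element of R. *)
Definition cabs (R : realType) (z : R[i]) : R := complex.Re `|z|.

Section cabs.
Variable R : realType.
Implicit Types z w : R[i].

Lemma cabs2E z : cabs z ^+ 2 = complex.Re z ^+ 2 + complex.Im z ^+ 2.
Proof. by rewrite /cabs normc_def/= sqr_sqrtr// addr_ge0// sqr_ge0. Qed.

Lemma cabs2M z w : cabs (z * w) ^+ 2 = cabs z ^+ 2 * cabs w ^+ 2.
Proof. by rewrite !cabs2E; case: z w => [a b] [c d] /=; ring. Qed.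

Lemma cabs2D z w : cabs (z + w) ^+ 2 <= 2 * cabs z ^+ 2 + 2 * cabs w ^+ 2.
Proof.
rewrite !cabs2E; case: z w => [a b] [c d] /=; rewrite -subr_ge0.
have -> : 2 * (a ^+ 2 + b ^+ 2) + 2 * (c ^+ 2 + d ^+ 2)
  - ((a + c) ^+ 2 + (b + d) ^+ 2) = (a - c) ^+ 2 + (b - d) ^+ 2 by ring.
by rewrite addr_ge0 ?sqr_ge0.
Qed.

Lemma cabs_ge0 z : 0 <= cabs z.
Proof. by rewrite /cabs normc_def/= sqrtr_ge0. Qed.

Lemma cabs_eq0 z : (cabs z == 0) = (z == 0).
Proof.
by rewrite -(inj_eq (@complexI R)) /cabs RRe_real ?normr_real// normr_eq0.
Qed.

Lemma Re_le_cabs z : `|complex.Re z| <= cabs z.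
Proof.
rewrite -(@ler_pXn2r _ 2)//= ?nnegrE ?cabs_ge0// cabs2E real_normK ?num_real//.
by rewrite lerDl sqr_ge0.
Qed.

Lemma Im_le_cabs z : `|complex.Im z| <= cabs z.
Proof.
rewrite -(@ler_pXn2r _ 2)//= ?nnegrE ?cabs_ge0// cabs2E real_normK ?num_real//.
by rewrite lerDr sqr_ge0.
Qed.

End cabs.

Lemma cauchy_seq_cvg (R : realType) (u : nat -> R) :
  (forall e : R, 0 < e -> exists N, forall m n, (N <= m)%N -> (N <= n)%N ->
    `|u m - u n| <= e) -> cvgn u.
Proof.
move=> uC; apply: cauchy_cvg; apply: cauchy_exP => e e0.
have [|N uN] := uC (e / 2); first by rewrite divr_gt0.
exists (u N); exists N => // n /= Nn; rewrite -ball_normE/=.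
by apply: (le_lt_trans (uN _ _ (leqnn N) Nn)); rewrite ltr_pdivrMr// ltr_pMr// ltr1n.
Qed.

Section L2.
Variables (T : pointedType) (R : realType) (mu : discreteMeasure T R).

Definition l2 : {pred T -> R[i]} :=
  mem [set f | (\int[mu]_x (cabs (f x) ^+ 2)%:E < +oo)%E].

Lemma l2_submod_closed : submod_closed l2.
Proof.
split.
  rewrite inE/= integral0_eq ?ltry// => x _.
  by rewrite cabs2E/= expr0n/= addr0.
move=> a f g; rewrite !inE/= => fl gl.
apply: (@le_lt_trans _ _ (\int[mu]_x
    ((2 * cabs a ^+ 2)%:E * (cabs (f x) ^+ 2)%:E
     + 2%:E * (cabs (g x) ^+ 2)%:E))%E).
  apply: ge0_le_integral => //=.
  - by move=> x _; rewrite lee_fin sqr_ge0.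
  - move=> x _; rewrite lee_fin.
    by apply: (le_trans (cabs2D _ _)); rewrite cabs2M mulrA.
have sq_ge0 z : (0 <= (cabs z ^+ 2)%:E)%E by rewrite lee_fin sqr_ge0.
have a_ge0 : (0 <= (2 * cabs a ^+ 2)%:E)%E by rewrite lee_fin mulr_ge0// sqr_ge0.
rewrite ge0_integralD//=; last 2 first.
  by move=> x _; rewrite mule_ge0.
  by move=> x _; rewrite mule_ge0// lee_fin.
rewrite !ge0_integralZl//=.
by rewrite lte_add_pinfty// lte_mul_pinfty// lee_fin.
Qed.

HB.instance Definition _ := GRing.isSubmodClosed.Build _ _ l2 l2_submod_closed.

(* No quotient by almost everywhere equality is needed: all point masses are
   positive, so that two functions equal almost everywhere are equal. *)
Record L2 : Type := MkL2 { L2_fun :> T -> R[i]; L2_subproof : L2_fun \in l2 }.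

HB.instance Definition _ := [isSub for L2_fun].
HB.instance Definition _ := [Choice of L2 by <:].
HB.instance Definition _ := [SubChoice_isSubLmodule of L2 by <:].

Implicit Types f g : L2.

Definition L2_inner f g : R[i] :=
  (\int[mu]_x complex.Re (f x * (g x)^*))%R
  +i* (\int[mu]_x complex.Im (f x * (g x)^*))%R.


Lemma L2_finite f : (\int[mu]_x (cabs (f x) ^+ 2)%:E < +oo)%E.
Proof. by have := L2_subproof f; rewrite inE. Qed.

Lemma L2_cross_integrable f g :
  mu.-integrable setT (fun x => (complex.Re (f x * (g x)^*))%:E) /\
  mu.-integrable setT (fun x => (complex.Im (f x * (g x)^*))%:E).
Proof.
have fg_int : mu.-integrable setT
    (fun x => (cabs (f x) ^+ 2)%:E + (cabs (g x) ^+ 2)%:E)%E.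
  apply/integrableP; split => //.
  under eq_integral do rewrite gee0_abs ?adde_ge0 ?lee_fin ?sqr_ge0//.
  rewrite ge0_integralD//=; try by move=> x _; rewrite lee_fin sqr_ge0.
  by rewrite lte_add_pinfty ?L2_finite.
split; apply: le_integrable fg_int => //= x _;
  rewrite lee_fin [leRHS]ger0_norm ?addr_ge0 ?sqr_ge0// !cabs2E;
  case: (f x) (g x) => [a b] [c d] /=; rewrite ler_norml;
  move: (sqr_ge0 a) (sqr_ge0 b) (sqr_ge0 c) (sqr_ge0 d);
  move: (sqr_ge0 (a - c)) (sqr_ge0 (a + c)) (sqr_ge0 (b - d)) (sqr_ge0 (b + d));
  move: (sqr_ge0 (a - d)) (sqr_ge0 (a + d)) (sqr_ge0 (b - c)) (sqr_ge0 (b + c));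
  rewrite !sqrrD !sqrrN => *; apply/andP; split; nra.
Qed.

Lemma Rintegral_comb (p q : R) (u v w : powerset_space T -> R) :
  mu.-integrable setT (EFin \o u) -> mu.-integrable setT (EFin \o v) ->
  mu.-integrable setT (EFin \o w) ->
  (\int[mu]_x (p * u x + q * v x + w x)
   = p * (\int[mu]_x u x) + q * (\int[mu]_x v x) + \int[mu]_x w x)%R.
Proof.
move=> iu iv iw.
have ipu : mu.-integrable setT (EFin \o (fun x => p * u x)).
  by have := integrableZl measurableT p iu; apply: eq_integrable.
have iqv : mu.-integrable setT (EFin \o (fun x => q * v x)).
  by have := integrableZl measurableT q iv; apply: eq_integrable.
rewrite RintegralD//; last first.
  by have := integrableD measurableT ipu iqv; apply: eq_integrable.
by rewrite RintegralD// !RintegralZl.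
Qed.

Lemma L2_inner_linear h : GRing.linear_for *%R (L2_inner ^~ h).
Proof.
move=> a f g; rewrite /L2_inner.
have [fR fI] := L2_cross_integrable f h.
have [gR gI] := L2_cross_integrable g h.
apply/eqP; rewrite eq_complex; case: a => a b; apply/andP; split; apply/eqP.
  rewrite [RHS]/= -mulNr -Rintegral_comb//.
  apply: eq_Rintegral => x _ /=.
  transitivity (complex.Re (((a +i* b) * f x + g x) * (h x)^*)); first by [].
  by case: (f x) (g x) (h x) => [? ?] [? ?] [? ?] /=; ring.
rewrite [RHS]/= -Rintegral_comb//.
apply: eq_Rintegral => x _ /=.
transitivity (complex.Im (((a +i* b) * f x + g x) * (h x)^*)); first by [].
by case: (f x) (g x) (h x) => [? ?] [? ?] [? ?] /=; ring.
Qed.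

Lemma L2_inner_herm f g : L2_inner f g = (L2_inner g f)^*.
Proof.
rewrite /L2_inner/=; congr (_ +i* _).
  apply: eq_Rintegral => x _; case: (f x) (g x) => [a b] [c d] /=; ring.
rewrite -[RHS]mulN1r -RintegralZl//; last by have [] := L2_cross_integrable g f.
apply: eq_Rintegral => x _; case: (f x) (g x) => [a b] [c d] /=; ring.
Qed.

Lemma L2_inner_norm f :
  L2_inner f f = (fine (\int[mu]_x (cabs (f x) ^+ 2)%:E))%:C.
Proof.
rewrite /L2_inner; apply/eqP; rewrite eq_complex /=; apply/andP; split; apply/eqP.
  congr fine; apply: eq_integral => x _; congr EFin.
  by rewrite cabs2E; case: (f x) => a b /=; ring.
rewrite (_ : (fun _ => _) = cst 0) ?Rintegral_cst ?mul0r//.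
by apply/funext => x /=; case: (f x) => a b /=; ring.
Qed.

Lemma L2_point_le f (x : T) :
  ((cabs (f x) ^+ 2)%:E * mu [set x] <= \int[mu]_x (cabs (f x) ^+ 2)%:E)%E.
Proof.
rewrite -integral_cst//=.
apply: (@le_trans _ _ (\int[mu]_(y in [set x]) (cabs (f y) ^+ 2)%:E)%E).
  rewrite le_eqVlt; apply/orP; left; apply/eqP.
  by apply: eq_integral => y; rewrite inE/= => ->.
by apply: ge0_subset_integral => //= y _; rewrite lee_fin sqr_ge0.
Qed.

Lemma L2_inner_gt0 f : f != 0 -> 0 < L2_inner f f.
Proof.
move=> f0; have [x fx0] : exists x, f x != 0.
  apply: contrapT => /forallNP fx0; move/negP: f0; apply; apply/eqP.
  by apply: val_inj; apply/funext => x/=; apply/eqP/negP => /negP/fx0.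
rewrite L2_inner_norm (_ : 0 = (0 : R)%:C)// ltcR fine_gt0// L2_finite andbT.
apply: lt_le_trans (L2_point_le f x).
by rewrite mule_gt0 ?discrete_gt0// lte_fin exprn_gt0// lt_def cabs_eq0 fx0 cabs_ge0.
Qed.

Lemma L2_bilinear : bilinear_for *%R (@Num.Def.conjC R[i] \; *%R) L2_inner.
Proof.
split=> [h|h]; first exact: L2_inner_linear.
move=> a f g /=.
rewrite L2_inner_herm L2_inner_linear rmorphD rmorphM /=.
by congr (_ * _ + _); rewrite [RHS]L2_inner_herm.
Qed.

Lemma L2_hermitian f g :
  L2_inner f g = (-1) ^+ false * Num.Def.conjC (L2_inner g f).
Proof. by rewrite expr0 mul1r; exact: L2_inner_herm. Qed.

HB.instance Definition _ :=
  @bilinear_isBilinear.Build _ L2 L2 _ _ _ L2_inner L2_bilinear.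
HB.instance Definition _ :=
  isHermitianSesquilinear.Build _ L2 false (@Num.Def.conjC R[i]) L2_inner
    L2_hermitian.
HB.instance Definition _ := isDotProduct.Build _ L2 L2_inner L2_inner_gt0.

Lemma L2_inner_le f (e : R) :
  (L2_inner f f <= e%:C) = (\int[mu]_x (cabs (f x) ^+ 2)%:E <= e%:E)%E.
Proof.
rewrite L2_inner_norm lecR -lee_fin fineK// ge0_fin_numE ?L2_finite//.
by apply: integral_ge0 => x _; rewrite lee_fin sqr_ge0.
Qed.

Lemma discrete_fin_num (x : T) : mu [set x] \is a fin_num.
Proof.
rewrite ge0_fin_numE//.
have [F FT Ffin] := discrete_sigma_finite mu.
have [k _ Fkx] : (\bigcup_k F k) x by rewrite -FT.
have [mFk Fkoo] := Ffin k.
by apply: le_lt_trans Fkoo; apply: le_measure; rewrite ?inE// => y ->.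
Qed.

Lemma L2_complete (u : nat -> L2) :
  (forall e : R, 0 < e -> exists N, forall m n, (N <= m)%N -> (N <= n)%N ->
    L2_inner (u m - u n) (u m - u n) <= e%:C) ->
  exists l : L2, forall e : R, 0 < e -> exists N, forall n, (N <= n)%N ->
    L2_inner (u n - l) (u n - l) <= e%:C.
Proof.
move=> uC.
have pointC (x : T) (e : R) : 0 < e -> exists N, forall m n,
    (N <= m)%N -> (N <= n)%N -> cabs (u m x - u n x) <= e.
  move=> e0; pose c := fine (mu [set x]).
  have c0 : 0 < c by rewrite fine_gt0// discrete_gt0 -ge0_fin_numE ?discrete_fin_num.
  have [N uN] := uC (e ^+ 2 * c) (mulr_gt0 (exprn_gt0 2 e0) c0).
  exists N => m n Nm Nn; have := uN m n Nm Nn.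
  rewrite L2_inner_le => /(le_trans (L2_point_le _ x)).
  rewrite -(fineK (discrete_fin_num x)) -EFinM lee_fin ler_pM2r//.
  by rewrite ler_pXn2r// nnegrE ?(ltW e0)// cabs_ge0.
have ReC x : cvgn (fun n => complex.Re (u n x)).
  apply: cauchy_seq_cvg => e /(pointC x)[N uN]; exists N => m n Nm Nn.
  by apply: le_trans (uN m n Nm Nn); rewrite -raddfB; exact: Re_le_cabs.
have ImC x : cvgn (fun n => complex.Im (u n x)).
  apply: cauchy_seq_cvg => e /(pointC x)[N uN]; exists N => m n Nm Nn.
  by apply: le_trans (uN m n Nm Nn); rewrite -raddfB; exact: Im_le_cabs.
pose l (x : T) : R[i] := limn (fun n => complex.Re (u n x)) +i* limn (fun n => complex.Im (u n x)).
have fatou_l (e : R) : 0 < e -> exists N, forall n, (N <= n)%N ->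
    (\int[mu]_x (cabs (u n x - l x) ^+ 2)%:E <= e%:E)%E.
  move=> e0; have [N uN] := uC e e0; exists N => n Nn.
  pose F m (x : powerset_space T) := (cabs (u n x - u m x) ^+ 2)%:E.
  have F_cvg x : F ^~ x @ \oo --> (cabs (u n x - l x) ^+ 2)%:E.
    apply: cvg_EFin; first by near=> m.
    under eq_fun do rewrite /F /= cabs2E !expr2.
    rewrite cabs2E !expr2 !raddfB /=.
    have ReB : complex.Re (u n x - u m x) @[m --> \oo] -->
        complex.Re (u n x) - complex.Re (l x).
      by under eq_fun do rewrite raddfB; apply: cvgB; [exact: cvg_cst|exact: ReC].
    have ImB : complex.Im (u n x - u m x) @[m --> \oo] -->
        complex.Im (u n x) - complex.Im (l x).
      by under eq_fun do rewrite raddfB; apply: cvgB; [exact: cvg_cst|exact: ImC].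
    by apply: cvgD; apply: cvgM.
  have -> : (\int[mu]_x (cabs (u n x - l x) ^+ 2)%:E =
             \int[mu]_x limn_einf (F ^~ x))%E.
    apply: eq_integral => x _.
    by rewrite is_cvg_limn_einfE ?(cvg_lim _ (F_cvg x))//; apply: cvgP (F_cvg x).
  apply: (le_trans (fatou _ _ _ _)) => //.
    by move=> m x _; rewrite lee_fin sqr_ge0.
  rewrite limn_einf_lim; apply: lime_le; first exact: is_cvg_einfs.
  near=> m; apply: (@le_trans _ _ (\int[mu]_x F m x)%E).
    by apply: ereal_inf_lbound; exists m => /=.
  have := uN n m Nn; rewrite L2_inner_le; apply.
  by near: m; exists N.
have [N0 lN0] := fatou_l 1 ltr01.
have l_l2 : l \in l2.
  have dl2 : (u N0 : T -> R[i]) - l \in l2.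
    by rewrite inE/=; apply: le_lt_trans (lN0 N0 (leqnn _)) (ltry _).
  have -> : l = (u N0 : T -> R[i]) - ((u N0 : T -> R[i]) - l) by rewrite subKr.
  by rewrite rpredB// L2_subproof.
pose L := MkL2 l_l2.
exists L => e e0; have [N lN] := fatou_l e e0; exists N => n Nn.
by rewrite L2_inner_le lN.
Unshelve. all: end_near. Qed.

HB.instance Definition _ := Lmodule_isHilbert.Build R L2 L2_complete.

Lemma L2_innerE f g : inner f g = L2_inner f g.
Proof. by []. Qed.

End L2.

Section unbounded_operators.
Variables (R : realType) (H : hilbertType R).
Implicit Types A B N : set (H * H).

(* An unbounded operator is represented by its graph, so that its domain is
   part of the data and no junk values are needed outside of it. *)
Definition is_operator A :=
  [/\ A (0, 0),
      forall (a : R[i]) p q, A p -> A q -> A (a *: p + q) &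
      forall y, A (0, y) -> y = 0].

Definition op_dom A : set H := [set p.1 | p in A].

Definition op_comp B A : set (H * H) :=
  [set p | exists2 y, A (p.1, y) & B (y, p.2)].

Definition op_pow A (n : nat) : set (H * H) :=
  iter n (op_comp A) [set p | p.2 = p.1].

Definition op_dom_infty A : set H := \bigcap_n op_dom (op_pow A n).

(* This is the graph of an operator only when A is densely defined. *)
Definition op_adjoint A : set (H * H) :=
  [set p | forall q, A q -> inner q.2 p.1 = inner q.1 p.2].

Definition normal_operator N :=
  [/\ is_operator N, dense (op_dom N), closed N &
      op_comp (op_adjoint N) N = op_comp N (op_adjoint N)].

End unbounded_operators.

Definition subnormal (R : realType) (H : hilbertType R) (A : set (H * H)) :=
  [/\ is_operator A, dense (op_dom A) &
      exists (K : hilbertType R) (V : {linear H -> K}) (N : set (K * K)),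
        [/\ forall f, `|V f| = `|f|, normal_operator N &
            forall f g, A (f, g) -> N (V f, V g)]].

Section composition_operators.
Variables (T : pointedType) (R : realType) (mu : discreteMeasure T R).
Variable phi : T -> T.

(* The second component lives in L2 mu, so f belongs to the domain iff the
   function f \o phi is square integrable. *)
Definition composition_operator : set (L2 mu * L2 mu) :=
  [set p : L2 mu * L2 mu | forall x, p.2 x = p.1 (phi x)].

Lemma composition_is_operator : is_operator composition_operator.
Proof.
split=> [x //|a [f1 f2] [g1 g2] /= fp gp x|g /= g0].
  transitivity (a * f2 x + g2 x); first by [].
  by rewrite fp gp.
by apply: val_inj; apply/funext => x /=; rewrite g0.
Qed.

Local Open Scope ereal_scope.

(* The sequence n |-> h_{phi^n}(x). *)
Definition radon_nikodym_seq (x : T) (n : nat) : \bar R :=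
  mu (iter n phi @^-1` [set x]) / mu [set x].

Definition consistency_condition (P : T -> probability R R) :=
  forall (x : T) (sigma : set R), range phi x -> measurable sigma ->
    sigma `<=` `[0%R, +oo[%classic ->
    ((mu [set x])^-1 *
       (\esum_(y in phi @^-1` [set x]) (mu [set y] * P y sigma)) =
     \int[P x]_(t in sigma) t%:E)%E.

End composition_operators.
Arguments composition_operator {T R} mu phi.

Section moments.
Variable R : realType.
Implicit Types (nu rho : {measure set R -> \bar R}) (u : nat -> \bar R).
Local Open Scope ereal_scope.

Definition closed_support nu : set R :=
  [set t | forall U : set R, open U -> U t -> 0 < nu U].

(* Borel measures on [0, +oo[ are represented by Borel measures on R with
   closed support in [0, +oo[. *)
Definition on_halfline nu := closed_support nu `<=` `[0%R, +oo[%classic.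

Definition finite_moments nu := forall n, \int[nu]_t (`|t| ^+ n)%:E < +oo.

(* Sequences are extended-real valued because the Radon-Nikodym derivatives
   are; an equality with the moments of a measure having finite moments forces
   all the terms to be finite. *)
Definition H_representing u nu :=
  finite_moments nu /\ forall n, u n = \int[nu]_t (t ^+ n)%:E.

Definition S_representing u nu := H_representing u nu /\ on_halfline nu.

Definition hamburger_moment_seq u := exists nu, H_representing u nu.

Definition stieltjes_moment_seq u := exists nu, S_representing u nu.

(* Measures are compared on measurable sets only: the value of a
   {measure set R -> \bar R} elsewhere is irrelevant. *)
Definition H_determinate u :=
  hamburger_moment_seq u /\
  forall nu1 nu2, H_representing u nu1 -> H_representing u nu2 ->
    forall A, measurable A -> nu1 A = nu2 A.

Definition S_determinate u :=
  stieltjes_moment_seq u /\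
  forall nu1 nu2, S_representing u nu1 -> S_representing u nu2 ->
    forall A, measurable A -> nu1 A = nu2 A.

Definition S_indeterminate u := stieltjes_moment_seq u /\ ~ S_determinate u.

Definition H_determinate_measure nu :=
  finite_moments nu /\ H_determinate (fun n => \int[nu]_t (t ^+ n)%:E).

End moments.

Section weighted_measure.
Variables (R : realType) (rho : {measure set R -> \bar R}) (z : R[i]) (k : nat).
Local Open Scope ereal_scope.

Definition weighted_measure (A : set R) : \bar R :=
  \int[rho]_(t in A) (cabs (t%:C - z) ^+ (2 * k))%:E.

Let weight_ge0 t : 0 <= (cabs (t%:C - z) ^+ (2 * k))%:E.
Proof. by rewrite lee_fin exprn_ge0// cabs_ge0. Qed.

Let weight_measurable :
  measurable_fun [set: R] (fun t : R => cabs (t%:C - z) ^+ (2 * k) : R)%R.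
Proof.
under eq_fun do rewrite exprM cabs2E.
case: z => a b /=; apply: measurable_funX; apply: measurable_funD => //=.
by apply: measurable_funX; apply: measurable_funD.
Qed.

Let weighted0 : weighted_measure set0 = 0.
Proof. by rewrite /weighted_measure integral_set0. Qed.

Let weighted_ge0 A : 0 <= weighted_measure A.
Proof. exact: integral_ge0. Qed.

Let weighted_sigma_additive : semi_sigma_additive weighted_measure.
Proof.
move=> F mF tF mUF; rewrite /weighted_measure ge0_integral_bigcup//=; last first.
  by apply/measurable_EFinP; exact: measurable_funTS.
by apply: is_cvg_ereal_nneg_natsum_cond => // n _ _; exact: integral_ge0.
Qed.

HB.instance Definition _ := isMeasure.Build _ R R weighted_measure
  weighted0 weighted_ge0 weighted_sigma_additive.

End weighted_measure.

Section index_of_determinacy.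
Variable R : realType.
Local Open Scope ereal_scope.

(* The supremum is taken in the extended reals: it is +oo when there are
   infinitely many such k. *)
Definition H_index (z : R[i]) (rho : {measure set R -> \bar R}) : \bar R :=
  ereal_sup [set k%:R%:E | k in
    [set k : nat | H_determinate_measure (weighted_measure rho z k)]].

(* The measure rho is unique (on Borel sets), by determinacy. *)
Definition has_H_index (z : R[i]) (u : nat -> \bar R) (d : \bar R) :=
  H_determinate u /\ exists2 rho, H_representing u rho & H_index z rho = d.

End index_of_determinacy.

Section vertices.
Variable kappa : nat.

(* [trunk r] is x_r for 0 <= r <= kappa, and [branch j] is x_{1, j+1}, so that
   [branch] enumerates { x_{1, j} : j >= 1 }. *)
Inductive vertex := trunk of 'I_kappa.+1 | branch of nat.

HB.instance Definition _ := gen_eqMixin vertex.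
HB.instance Definition _ := gen_choiceMixin vertex.
HB.instance Definition _ := isPointed.Build vertex (trunk ord0).

(* [ord_pred] is the cyclic predecessor of 'I_kappa.+1: it maps 0 to kappa. *)
Definition vertex_map (x : vertex) : vertex :=
  match x with
  | trunk r => trunk (ord_pred r)
  | branch 0 => trunk ord_max
  | branch j.+1 => branch j
  end.

End vertices.
Arguments trunk {kappa} r.
Arguments branch {kappa} j.

(* Main.v *)
From HB Require Import structures.
Require Import Defs.
From mathcomp Require Import all_boot all_order all_algebra complex.
From mathcomp Require Import all_classical all_reals all_analysis.
From mathcomp Require Import measurable_realfun ring lra zify.

(** Everything comes from a signed measure with vanishing moments. For
    0 < p < 1 put t_n = p^(-n) and W_n = p^(n(n-1)/2) / ((1-p) ... (1-p^n)).
    By Euler's identity, sum_n (-1)^n W_n z^n = prod_i (1 - z p^i), and the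
    product is zero at z = p^(-m), so the measure eta with mass (-1)^n W_n at
    t_n has all its moments of order m >= 0 equal to zero. Hence its positive
    part rho (n even) and its negative part tau (n odd) have the same moments
    ([parity_moments]), and so do the two parts of the product of eta with a
    polynomial.

    The lowest atom of rho is t_0 = 1, with mass 1; let alpha be rho without
    this atom. The atoms of tau are larger than 1; let nu be the measure
    (t^(kappa+1) - 1) t^(-kappa) tau. Give x_{1,j} the mass of order j-1 of nu
    and x_r the mass (integral of t^(r-kappa) with respect to tau) - 1. Sums
    over the preimages of x_kappa telescope, and h_{phi^n}(x_kappa) is, up to
    normalisation, the moment of order n of tau - delta_1, which is also that
    of alpha, while h_{phi^n}(x_{1,j}) is that of t^(j-1) nu. With
    P(x_{1,1}, .) = nu normalised, the left-hand side of (i-d) is S / (S - 1),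
    where S is the integral of t^(-kappa) with respect to tau: it exceeds 1
    because the unit mass at t = 1 has been removed. The masses are positive
    as soon as S > 1, and p = (kappa+1)/(kappa+2) ensures it: the atom t_1
    alone contributes p^kappa / (1 - p).

    Determinacy of alpha. Let Q_N be the product of 1 - x p^(2j) for
    1 <= j <= N; it vanishes at the first N atoms of alpha. The integral of
    Q_N^2 with respect to alpha tends to 0, whereas Q_N^2 stays bounded below
    at every point which is not an atom. Another measure beta with the moments
    of alpha gives the same integrals, so it is carried by the atoms of alpha.
    Leaving out the factor that vanishes at one atom shows that beta has
    there at most the mass of alpha, and then the equality of the total masses
    forces beta = alpha ([H_determinate_atomic], [H_determinate_alpha]). The
    index at 0 is 0: for k >= 1, subtracting (t-1) t^(2k-1) eta from
    t^(2k) alpha gives another positive measure with the same moments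
    ([H_index_alpha]). Likewise t^j nu + t^j (t-1) eta is positive, which
    makes the sequences along the branch S-indeterminate
    ([S_indeterminate_branch]).

    Let kappa = 0. Then (t-1) alpha has the moments of nu, and the measures
    alpha and t^(j-1) (t-1) alpha, normalised, satisfy the consistency
    condition ([loop_consistency]). They also show how to extend the operator:
    over each atom t of alpha, unroll the loop at x_0 into a half-line, so that
    the orbit becomes a copy of the integers, and give the integer m the mass
    (t-1) t^m. The shift multiplies these masses by t, which makes its
    composition operator normal ([bijective_composition_normal]). The unrolled
    half-line has total mass 1, as the loop should, so that composing with the
    projection onto the graph embeds one space isometrically into the other
    ([subnormal_of_factor]). *)

Set Implicit Arguments.
Unset Strict Implicit.
Unset Printing Implicit Defensive.
Import Order.TTheory GRing.Theory Num.Theory.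
Import numFieldNormedType.Exports.
Local Open Scope classical_set_scope.
Local Open Scope ring_scope.

(** * Sums of real series *)

Section has_sum.
Variable R : realType.
Implicit Types (u v : nat -> R) (l m : R).

(** Sums of series as a relation rather than a value: the identities between
    moments below add and subtract sums, which needs their convergence, and
    this relation carries it along. *)
Definition has_sum u l := series u @ \oo --> l.

Lemma has_sum_eq u v l : has_sum u l -> u =1 v -> has_sum v l.
Proof. by move=> ul /funext <-. Qed.

Lemma has_sum_unique u l m : has_sum u l -> has_sum u m -> l = m.
Proof. by move=> ul um; apply: (cvg_unique _ ul um). Qed.

Lemma has_sumD u v l m :
  has_sum u l -> has_sum v m -> has_sum (fun n => u n + v n) (l + m).
Proof. by move=> ul vm; rewrite /has_sum seriesD; exact: cvgD. Qed.

Lemma has_sumZ (c : R) u l : has_sum u l -> has_sum (fun n => c * u n) (c * l).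
Proof.
move=> ul; rewrite /has_sum (_ : series _ = fun n => c * series u n).
  exact: cvgMr.
by apply/funext => n; rewrite /series/= mulr_sumr.
Qed.

Lemma has_sumN u l : has_sum u l -> has_sum (fun n => - u n) (- l).
Proof.
by move=> ul; rewrite -mulN1r; apply: has_sum_eq (has_sumZ (c := -1) ul) _ => n; rewrite mulN1r.
Qed.

Lemma has_sumB u v l m :
  has_sum u l -> has_sum v m -> has_sum (fun n => u n - v n) (l - m).
Proof. by move=> ul /has_sumN; exact: has_sumD. Qed.

Definition shift u n := if n is k.+1 then u k else 0.

Lemma has_sum_shift u l : has_sum u l -> has_sum (shift u) l.
Proof.
move=> ul; rewrite /has_sum -(cvg_shiftS (series (shift u))).
rewrite (_ : (fun n => _) = series u)//; apply/funext => n.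
by rewrite /series/= big_nat_recl//= add0r.
Qed.

Lemma has_sum_atom (k : nat) (c : R) :
  has_sum (fun n => if n == k then c else 0) c.
Proof.
elim: k => [|k /has_sum_shift IH]; last first.
  by apply: has_sum_eq IH _; case => [|n] //=; rewrite eqSS.
rewrite /has_sum -(cvg_shiftS (series _)).
rewrite (_ : (fun n => _) = cst c); first exact: cvg_cst.
by apply/funext => n; rewrite /series/= big_nat_recl//= big1 ?addr0.
Qed.

Lemma has_sum_nneseries u l : (forall n, 0 <= u n) -> has_sum u l ->
  (\sum_(n <oo) (u n)%:E = l%:E)%E.
Proof.
move=> u0 ul; apply: cvg_lim => //.
rewrite (_ : (fun n => _) = EFin \o series u); first by apply: cvg_EFin => //; exact: nearW.
by apply/funext => n /=; rewrite sumEFin.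
Qed.

Lemma nneseries_has_sum u : (forall n, 0 <= u n) ->
  (\sum_(n <oo) (u n)%:E < +oo)%E -> exists l, has_sum u l.
Proof.
move=> u0 uoo; apply/cvg_ex.
apply: nondecreasing_is_cvgn.
  by apply: nondecreasing_series.
exists (fine (\sum_(n <oo) (u n)%:E)%E) => _ [n _ <-].
rewrite -lee_fin fineK; last first.
  by rewrite ge0_fin_numE ?nneseries_ge0// => *; rewrite lee_fin.
rewrite /series/= -sumEFin.
by apply: nneseries_lim_ge => *; rewrite lee_fin.
Qed.

Lemma has_sum_ge_term u l k : (forall n, 0 <= u n) -> has_sum u l -> u k <= l.
Proof.
move=> u0 ul; rewrite -lee_fin -(has_sum_nneseries u0 ul).
apply: (@le_trans _ _ (\sum_(0 <= n < k.+1) (u n)%:E)%E).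
  by rewrite sumEFin lee_fin big_nat_recr//= lerDr sumr_ge0.
by apply: nneseries_lim_ge => *; rewrite lee_fin.
Qed.

Lemma has_sum_ge0 u l : (forall n, 0 <= u n) -> has_sum u l -> 0 <= l.
Proof. by move=> u0 ul; apply: le_trans (has_sum_ge_term 0 u0 ul). Qed.

Lemma has_sum_gt0 u l k : (forall n, 0 <= u n) -> 0 < u k -> has_sum u l -> 0 < l.
Proof. by move=> u0 uk ul; apply: lt_le_trans uk (has_sum_ge_term k u0 ul). Qed.

Lemma has_sum_le u v l m : (forall n, u n <= v n) ->
  has_sum u l -> has_sum v m -> l <= m.
Proof.
move=> uv ul vm; rewrite -subr_ge0.
by apply: has_sum_ge0 (has_sumB vm ul) => n; rewrite subr_ge0.
Qed.

Lemma has_sum_dominated u v m : (forall n, 0 <= u n <= v n) ->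
  has_sum v m -> exists l, has_sum u l.
Proof.
move=> uv vm.
have u0 n : 0 <= u n by have /andP[] := uv n.
apply: nneseries_has_sum => //; apply: (@le_lt_trans _ _ m%:E); last exact: ltry.
rewrite -(@has_sum_nneseries v)//; last first.
  by move=> n; have /andP[] := uv n; exact: le_trans.
by apply: lee_nneseries => n *; rewrite lee_fin; have /andP[] := uv n.
Qed.

Lemma has_sum_geometric (p : R) : 0 <= p < 1 -> has_sum (fun n => p ^+ n) (1 - p)^-1.
Proof.
move=> /andP[p0 p1].
have := @cvg_geometric_series R 1 p; rewrite mul1r ger0_norm// => /(_ p1).
by rewrite (_ : geometric 1 p = fun n => p ^+ n)//; apply/funext => n; rewrite /geometric/= mul1r.
Qed.

End has_sum.

(** * Products bounded away from zero *)

Section products.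
Variables (R : realType) (p : R).
Hypotheses (p0 : 0 < p) (p1 : p < 1).

Lemma prod1B_ge (y : nat -> R) (J n : nat) :
  (forall j, (J <= j < J + n)%N -> `|y j| <= 1) ->
  1 - \sum_(J <= j < J + n) `|y j| <= \prod_(J <= j < J + n) `|1 - y j|.
Proof.
elim: n => [|n IH] y1; first by rewrite addn0 !big_geq// subr0.
rewrite addnS !big_nat_recr ?leq_addr//=.
have {}IH : 1 - \sum_(J <= j < J + n) `|y j| <= \prod_(J <= j < J + n) `|1 - y j|.
  by apply: IH => j /andP[Jj jn]; apply: y1; rewrite Jj/=; lia.
set S := \sum_(_ <= _ < _) _ in IH *; set Q := \prod_(_ <= _ < _) _ in IH *.
have S0 : 0 <= S by apply: sumr_ge0.
have Q0 : 0 <= Q by apply: prodr_ge0.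
have yn : `|y (J + n)%N| <= 1 by apply: y1; lia.
have : 1 - `|y (J + n)%N| <= `|1 - y (J + n)%N|.
  by rewrite -{1}(normr1 R); exact: lerB_dist.
have := normr_ge0 (y (J + n)%N).
move: `|y _| yn `|1 - _| => a a1 c a0 ac.
have : (1 - a) * Q <= c * Q by apply: ler_wpM2r.
have : (1 - a) * (1 - S) <= (1 - a) * Q by apply: ler_wpM2l => //; lra.
have : 0 <= a * S by apply: mulr_ge0.
move: (c * Q) => cQ; nra.
Qed.

Lemma geo_tail (J n : nat) : \sum_(J <= j < J + n) p ^+ j <= p ^+ J / (1 - p).
Proof.
have p1' : 0 < 1 - p by rewrite subr_gt0.
rewrite ler_pdivlMr//.
suff -> : (\sum_(J <= j < J + n) p ^+ j) * (1 - p) = p ^+ J - p ^+ (J + n).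
  by rewrite lerBlDr lerDl exprn_ge0// ltW.
elim: n => [|n IH]; first by rewrite addn0 big_geq// mul0r subrr.
rewrite addnS big_nat_recr ?leq_addr//= mulrDl IH exprS; ring.
Qed.

(** The factors beyond some rank J have deviations from 1 of total size at most
    1/2, so their product is at least 1/2; finitely many nonzero factors
    remain. This bounds from below both (1-p)...(1-p^n) and the test
    polynomials off their zeros. *)
Lemma prod1B_lower_bound (M : R) (y : nat -> R) :
  (forall j, `|y j| <= M * p ^+ j) -> (forall j, y j != 1) ->
  exists2 d, 0 < d & forall N, d <= \prod_(j < N) `|1 - y j|.
Proof.
move=> yM y1.
have M0 : 0 <= M by have := le_trans (normr_ge0 _) (yM 0%N); rewrite mulr1.
have fac0 j : 0 < `|1 - y j| by rewrite normr_gt0 subr_eq0 eq_sym.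
pose A N := \prod_(0 <= j < N) `|1 - y j|.
have A0 N : 0 < A N by rewrite /A big_mkord; apply: prodr_gt0.
have [J JM] : exists J, M * p ^+ J / (1 - p) <= 2^-1.
  have : (fun n => M / (1 - p) * p ^+ n) @ \oo --> M / (1 - p) * 0.
    by apply: cvgMr; apply: cvg_expr; rewrite ger0_norm// ltW.
  rewrite mulr0 => /cvgrPdist_le /(_ 2^-1)[]; first by rewrite invr_gt0.
  move=> J _ /(_ J (leqnn J)) /=; rewrite sub0r normrN => /(le_trans (ler_norm _)).
  by exists J; rewrite mulrAC.
have small n : \sum_(J <= j < J + n) `|y j| <= 2^-1.
  apply: le_trans JM; rewrite -mulrA; apply: le_trans (ler_wpM2l M0 (geo_tail J n)).
  by rewrite mulr_sumr; apply: ler_sum.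
have tail n : A J * 2^-1 <= A (J + n)%N.
  rewrite {2}/A (@big_cat_nat _ _ _ J) ?leq_addr//=.
  rewrite ler_pM2l//; apply: le_trans (@prod1B_ge y J n _).
    have := small n; lra.
  move=> j /andP[Jj jn]; apply: (le_trans _ (le_trans (small n) _)); last by lra.
  rewrite (@big_cat_nat _ _ _ j) ?(ltnW jn)//= [X in _ + X]big_ltn// addrCA lerDl.
  by rewrite addr_ge0// sumr_ge0.
have [d d0 dA] : exists2 d, 0 < d & forall N, (N <= J)%N -> d <= A N.
  elim: {small tail JM} J => [|J [d d0 dA]].
    by exists (A 0%N) => // N; rewrite leqn0 => /eqP->.
  exists (Num.min d (A J.+1)); first by rewrite lt_min d0 A0.
  move=> N; rewrite leq_eqVlt ltnS => /orP[/eqP->|/dA dN].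
    by rewrite ge_min lexx orbT.
  by rewrite ge_min dN.
exists (Num.min d (A J * 2^-1)).
  by rewrite lt_min d0 mulr_gt0.
move=> N; rewrite -(big_mkord xpredT (fun j => `|1 - y j|)) ge_min.
have [/dA ->//|JN] := leqP N J.
by apply/orP; right; have := tail (N - J)%N; rewrite subnKC// ltnW.
Qed.

End products.

(** * The q-exponential weights and the masses of the vertices *)

Section weights.
Variables (R : realType) (p : R).
Hypotheses (p0 : 0 < p) (p1 : p < 1).

Definition qpoint (n : nat) : R := p ^- n.

Definition weight (n : nat) : R := \prod_(i < n) (p ^+ i / (1 - p ^+ i.+1)).

Lemma pX_gt0 n : 0 < p ^+ n. Proof. exact: exprn_gt0. Qed.

Lemma pX_neq0 n : p ^+ n != 0. Proof. by rewrite gt_eqF ?pX_gt0. Qed.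

Lemma pX_lt1 n : p ^+ n.+1 < 1.
Proof. by rewrite exprn_ilt1// ltW. Qed.

Lemma qpoint_gt0 n : 0 < qpoint n.
Proof. by rewrite invr_gt0 pX_gt0. Qed.

Lemma qpoint_gt1 n : 1 < qpoint n.+1.
Proof. by rewrite invf_gt1 ?pX_gt0// pX_lt1. Qed.

Lemma qpoint0 : qpoint 0 = 1. Proof. by rewrite /qpoint expr0 invr1. Qed.

Lemma qpoint_ge1 n : 1 <= qpoint n.
Proof. by case: n => [|n]; [rewrite qpoint0|exact/ltW/qpoint_gt1]. Qed.

Lemma qpointS n : qpoint n.+1 = p^-1 * qpoint n.
Proof. by rewrite /qpoint exprS invfM. Qed.

Lemma pX_qpoint n : p ^+ n * qpoint n = 1.
Proof. by rewrite /qpoint divff// pX_neq0. Qed.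

Lemma qpoint_inj : injective qpoint.
Proof.
have mono (m n : nat) : (m < n)%N -> qpoint m < qpoint n.
  move=> mn; rewrite /qpoint ltf_pV2 ?posrE ?pX_gt0//.
  by rewrite ltr_iXn2l.
move=> m n mn; case: (ltngtP m n) => // /mono; by rewrite mn ltxx.
Qed.

Lemma weight0 : weight 0 = 1. Proof. by rewrite /weight big_ord0. Qed.

Lemma weight_gt0 n : 0 < weight n.
Proof.
by apply: prodr_gt0 => i _; rewrite divr_gt0 ?pX_gt0// subr_gt0 pX_lt1.
Qed.

Lemma weightS n : weight n.+1 = weight n * (p ^+ n / (1 - p ^+ n.+1)).
Proof. by rewrite /weight big_ord_recr. Qed.

Lemma weight_rec n : weight n.+1 = weight n.+1 * p ^+ n.+1 + weight n * p ^+ n.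
Proof.
rewrite weightS; field.
by rewrite subr_eq0 gt_eqF// pX_lt1.
Qed.

Lemma qpoint_weight_rec n s : weight n.+1 * qpoint n.+1 ^+ s =
  weight n.+1 * qpoint n.+1 ^+ s * p ^+ n.+1 +
  p^-1 ^+ s * (weight n * qpoint n ^+ s * p ^+ n).
Proof.
rewrite {1}weight_rec mulrDl; congr (_ + _); first by rewrite mulrAC.
by rewrite qpointS exprMn; ring.
Qed.

Lemma pochhammer_lower_bound :
  exists2 d, 0 < d & forall n, d <= \prod_(i < n) (1 - p ^+ i.+1).
Proof.
have [|j|d d0 dP] := @prod1B_lower_bound R p p0 p1 1 (fun j => p ^+ j.+1).
- by move=> j; rewrite mul1r ger0_norm ?(ltW (pX_gt0 _))// exprS ler_piMl ?(ltW (pX_gt0 _))// ltW.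
- by rewrite lt_eqF// pX_lt1.
exists d => // n; rewrite (eq_bigr (fun i : 'I_n => `|1 - p ^+ i.+1|)).
  exact: dP.
by move=> i _; rewrite ger0_norm// subr_ge0 ltW// pX_lt1.
Qed.

Lemma weight_bound : exists2 C, 0 < C & forall n, weight n <= C.
Proof.
have [d d0 dP] := pochhammer_lower_bound.
exists d^-1; first by rewrite invr_gt0.
move=> n; rewrite /weight big_split/= prodfV.
apply: (@le_trans _ _ (1 * (\prod_(i < n) (1 - p ^+ i.+1))^-1)).
  apply: ler_wpM2r.
    by rewrite invr_ge0; apply/ltW/(lt_le_trans d0 (dP n)).
  by apply: prodr_ile1 => i _; rewrite (ltW (pX_gt0 _)) exprn_ile1// ltW.
rewrite mul1r lef_pV2 ?posrE//; exact: (lt_le_trans d0 (dP n)).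
Qed.

Definition parity_term (e : bool) (s n : nat) : R :=
  (odd n == e)%:R * (weight n * qpoint n ^+ s).

Lemma parity_term_ge0 e s n : 0 <= parity_term e s n.
Proof.
by rewrite mulr_ge0 ?ler0n// ltW// mulr_gt0 ?weight_gt0// exprn_gt0// qpoint_gt0.
Qed.

(** Coefficientwise, the functional equation f(z) = (1 - z) f(pz) of the
    q-exponential relates the even and odd sums E_s and O_s of order s to
    those of order s - 1:
    E_s = E_(s-1) + p^(-s) O_(s-1) and O_s = O_(s-1) + p^(-s) E_(s-1).
    At s = 0 both right-hand sides are E_(-1) + O_(-1), so E_0 = O_0, and
    the equality then propagates to all s. Convergence propagates with it, from
    the geometric domination of the sums of order -1. *)
Lemma parity_moments s : exists l, forall e, has_sum (parity_term e s) l.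
Proof.
have split_moment (k : nat) (f : bool -> R) :
    (forall e, has_sum (fun n => parity_term e k n * p ^+ n) (f e)) ->
    forall e, has_sum (parity_term e k) (f e + p^-1 ^+ k * f (~~ e)).
  move=> fk e.
  apply: has_sum_eq (has_sumD (fk e) (has_sumZ (c := p^-1 ^+ k) (has_sum_shift (fk (~~ e))))) _.
  case=> [|n] /=; first by rewrite mulr0 addr0 mulr1.
  rewrite /parity_term [in RHS]qpoint_weight_rec /=.
  by case: (odd n) e => -[] /=; ring.
elim: s => [|s [l ls]].
  have [C C0 WC] := weight_bound.
  have /choice[f fP] : forall e, exists l, has_sum (fun n => parity_term e 0 n * p ^+ n) l.
    move=> e.
    apply: has_sum_dominated (has_sumZ (c := C) (has_sum_geometric (p := p) _)); last first.
      by rewrite (ltW p0) p1.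
    move=> n; rewrite mulr_ge0 ?parity_term_ge0 ?(ltW (pX_gt0 _))//=.
    rewrite ler_wpM2r ?(ltW (pX_gt0 _))// /parity_term expr0 mulr1.
    by case: eqP; rewrite ?mul1r ?mul0r ?WC// ltW.
  exists (f false + f true) => e; have := split_moment 0%N f fP e.
  by rewrite expr0 mul1r; case: e => //=; rewrite addrC.
exists (l + p^-1 ^+ s.+1 * l) => e.
apply: (split_moment _ (fun=> l)) => e'.
apply: has_sum_eq (ls e') _ => n; rewrite /parity_term exprSr.
by rewrite -!mulrA [_ * p ^+ n]mulrC pX_qpoint mulr1.
Qed.

End weights.

Lemma bernoulli_ineq (R : realType) (p : R) n : 0 <= p -> p <= 1 ->
  1 - n%:R * (1 - p) <= p ^+ n.
Proof.
move=> p0 p1; elim: n => [|n IH]; first by rewrite mul0r subr0 expr0.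
rewrite exprS; apply: le_trans (ler_wpM2l p0 IH).
rewrite -natr1; have : 0 <= n%:R * (1 - p) ^+ 2 by rewrite mulr_ge0// sqr_ge0.
by rewrite expr2; nra.
Qed.

Section masses.
Variables (R : realType) (kappa : nat).

(** Close enough to 1 for p^kappa + p > 1, which makes the masses positive, see
    [trunk_mass0_gt0]. *)
Definition qratio : R := kappa.+1%:R / kappa.+2%:R.
Local Notation p := qratio.

Lemma qratio_gt0 : 0 < p. Proof. by rewrite divr_gt0. Qed.

Lemma qratio_lt1 : p < 1.
Proof. by rewrite ltr_pdivrMr// mul1r ltr_nat. Qed.

Let p0 := qratio_gt0.
Let p1 := qratio_lt1.

Local Notation t := (qpoint p).
Local Notation W := (weight p).

(** The atoms of t^(s-kappa) tau, whose total mass less 1 is, for s <= kappa, the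
    mass of x_s. *)
Definition trunk_term (s n : nat) : R := (odd n)%:R * (W n * t n ^+ s / t n ^+ kappa).

Lemma trunk_term_ge0 s n : 0 <= trunk_term s n.
Proof.
by rewrite mulr_ge0// divr_ge0 ?exprn_ge0 ?(ltW (qpoint_gt0 _ _))// mulr_ge0
  ?exprn_ge0 ?(ltW (qpoint_gt0 _ _))// ?(ltW (weight_gt0 _ _ _)).
Qed.

Definition trunk_mass (s : nat) : R := limn (series (trunk_term s)) - 1.
Local Notation a := trunk_mass.

Lemma has_sum_trunk s : has_sum (trunk_term s) (a s + 1).
Proof.
rewrite /trunk_mass subrK.
have [l /(_ true) ls] := parity_moments p0 p1 s.
have [m sm] : exists l, has_sum (trunk_term s) l.
  apply: has_sum_dominated ls => n; rewrite trunk_term_ge0/=.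
  rewrite /trunk_term /parity_term eqb_id ler_wpM2l// ler_pdivrMr ?exprn_gt0 ?qpoint_gt0//.
  rewrite ler_peMr ?exprn_ege1 ?qpoint_ge1//.
  by rewrite mulr_ge0 ?exprn_ge0 ?(ltW (qpoint_gt0 _ _))// ?(ltW (weight_gt0 _ _ _)).
by rewrite (cvg_lim _ sm).
Qed.

Definition even_term (s n : nat) : R := (~~ odd n && (n != 0))%:R * (W n * t n ^+ s).

(** The equality of the even and odd moments; the 1 subtracted from the odd one
    is the atom at t_0 = 1 that is removed from the even one. *)
Lemma has_sum_even s : has_sum (even_term s) (a (s + kappa)).
Proof.
have [l ls] := parity_moments p0 p1 s.
have -> : a (s + kappa) = l - 1.
  rewrite -[LHS](addrK 1); congr (_ - 1); apply: (has_sum_unique (@has_sum_trunk (s + kappa))).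
  apply: has_sum_eq (ls true) _ => n; rewrite /parity_term /trunk_term eqb_id.
  have tn0 : t n ^+ kappa != 0 by rewrite expf_neq0// gt_eqF// qpoint_gt0// qratio_gt0.
  by rewrite exprD; field.
apply: has_sum_eq (has_sumB (ls false) (@has_sum_atom R 0%N 1)) _ => n.
rewrite /parity_term /even_term eqbF_neg.
case: n => [|n] /=; last by rewrite andbT subr0.
by rewrite weight0 qpoint0 expr1n !mulr1 subrr.
Qed.

(** The atom t_1 contributes p^kappa / (1 - p) to the sum, and Bernoulli's
    inequality gives p^kappa >= 1 - kappa (1 - p) > 1 - p. *)
Lemma trunk_mass0_gt0 : 0 < a 0.
Proof.
have := has_sum_ge_term 1 (trunk_term_ge0 0) (@has_sum_trunk 0).
rewrite /trunk_term /= mul1r expr0 mulr1 weightS weight0 mul1r expr0 expr1.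
rewrite /qpoint expr1 exprVn invrK => H; suff : 1 < 1 / (1 - p) * p ^+ kappa by lra.
have q0 : 0 < 1 - p by have := p1; lra.
rewrite mulrAC mul1r ltr_pdivlMr// mul1r.
apply: lt_le_trans (bernoulli_ineq kappa (ltW p0) (ltW p1)).
have -> : 1 - p = kappa.+2%:R^-1.
  by rewrite /qratio -!natr1; field; rewrite !natr1 pnatr_eq0.
have k2 : (0 : R) < kappa.+2%:R by [].
rewrite -subr_gt0.
have -> : 1 - kappa%:R / kappa.+2%:R - kappa.+2%:R^-1 = kappa.+2%:R^-1 :> R.
  by rewrite -!natr1; field; rewrite !natr1 pnatr_eq0.
by rewrite invr_gt0.
Qed.

(** The value that makes sums over preimages telescope; it is also the moment of
    order j of nu, see [has_sum_branch]. *)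
Definition branch_mass (j : nat) : R := a (j + kappa.+1) - a j.

(** The atoms of t^j nu. *)
Definition branch_term (j n : nat) : R :=
  (odd n)%:R * (W n * t n ^+ j * (t n - t n ^- kappa)).

Lemma qpoint_sub_ge0 n : 0 <= t n - t n ^- kappa.
Proof.
rewrite subr_ge0; apply: le_trans (qpoint_ge1 p0 p1 n).
by rewrite invf_le1 ?exprn_gt0 ?qpoint_gt0// exprn_ege1// qpoint_ge1.
Qed.

Lemma branch_term_ge0 j n : 0 <= branch_term j n.
Proof.
by rewrite mulr_ge0// mulr_ge0 ?qpoint_sub_ge0// mulr_ge0 ?exprn_ge0
  ?(ltW (qpoint_gt0 _ _))// ?(ltW (weight_gt0 _ _ _)).
Qed.

Lemma has_sum_branch j : has_sum (branch_term j) (branch_mass j).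
Proof.
have -> : branch_mass j = a (j + kappa.+1) + 1 - (a j + 1).
  by rewrite /branch_mass; ring.
apply: has_sum_eq (has_sumB (@has_sum_trunk _) (@has_sum_trunk _)) _ => n.
rewrite /trunk_term /branch_term addnS -addSn exprD.
have tn0 : t n ^+ kappa != 0 by rewrite expf_neq0// gt_eqF// qpoint_gt0.
by rewrite exprSr; field.
Qed.

Lemma branch_mass_gt0 j : 0 < branch_mass j.
Proof.
apply: (@has_sum_gt0 _ _ _ 1%N (branch_term_ge0 j) _ (@has_sum_branch j)).
rewrite /branch_term mul1r mulr_gt0//.
  by rewrite mulr_gt0 ?exprn_gt0 ?qpoint_gt0 ?weight_gt0.
rewrite subr_gt0; apply: (@le_lt_trans _ _ 1); last exact: qpoint_gt1.
by rewrite invf_le1 ?exprn_gt0 ?qpoint_gt0// exprn_ege1// qpoint_ge1.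
Qed.

Lemma trunk_mass_gt0 s : 0 < a s.
Proof.
apply: lt_le_trans trunk_mass0_gt0 _; rewrite -(lerD2r 1).
apply: has_sum_le (@has_sum_trunk 0) (@has_sum_trunk s) => n.
rewrite /trunk_term ler_wpM2l// ler_wpM2r//.
  by rewrite invr_ge0 exprn_ge0// ltW// qpoint_gt0.
by rewrite ler_wpM2l ?(ltW (weight_gt0 _ _ _))// expr0 exprn_ege1// qpoint_ge1.
Qed.

End masses.

(** * Purely atomic measures on the line *)

Section atomic.
Variables (R : realType) (t w : nat -> R).
Local Open Scope ereal_scope.

(** The absolute value makes the weights nonnegative without a proof argument;
    it is harmless since the lemmas below assume nonnegative weights. *)
Definition atomic : {measure set R -> \bar R} :=
  mseries (fun n => mscale (`|w n|%:nng)%R \d_(t n)) 0.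

Hypothesis w0 : (forall n, 0 <= w n)%R.

Lemma atomicE A : atomic A = \sum_(n <oo) (w n)%:E * \d_(t n) A.
Proof.
by apply: eq_eseriesr => n _; rewrite /= /mscale/= ger0_norm.
Qed.

Lemma ge0_integral_atomic (D : set R) (f : R -> \bar R) : measurable D ->
  measurable_fun D f -> (forall x, 0 <= f x) ->
  \int[atomic]_(x in D) f x = \sum_(n <oo) (w n)%:E * (\d_(t n) D * f (t n)).
Proof.
move=> mD mf f0; rewrite ge0_integral_measure_series//.
apply: eq_eseriesr => n _.
rewrite ge0_integral_mscale// integral_dirac//.
by rewrite /= ger0_norm.
Qed.

(** The integrand may be negative off the atoms, as odd powers are. *)
Lemma integral_atomic (D : set R) (f : R -> \bar R) : measurable D ->
  measurable_fun D f -> (forall n, 0 <= f (t n)) ->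
  \int[atomic]_(x in D) f x = \sum_(n <oo) (w n)%:E * (\d_(t n) D * f (t n)).
Proof.
move=> mD mf f0; rewrite integralE.
rewrite [X in _ - X]ge0_integral_atomic//; last exact: measurable_funeneg.
rewrite [X in _ - X]eseries0 ?sube0; last first.
  by move=> n _ _; rewrite funenegE max_r ?mule0// leeNl oppe0.
rewrite ge0_integral_atomic//; last exact: measurable_funepos.
by apply: eq_eseriesr => n _; rewrite funeposE max_l.
Qed.

Lemma integral_atomic_has_sum (D : set R) (f : R -> R) (l : R) :
  measurable D -> measurable_fun D f -> (forall n, D (t n)) ->
  (forall n, (0 <= f (t n))%R) -> has_sum (fun n => w n * f (t n))%R l ->
  \int[atomic]_(x in D) (f x)%:E = l%:E.
Proof.
move=> mD mf Dt f0 fl; rewrite integral_atomic//; last exact/measurable_EFinP.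
rewrite -(has_sum_nneseries _ fl); last by move=> n; rewrite mulr_ge0.
by apply: eq_eseriesr => n _; rewrite diracE mem_set ?mul1e ?EFinM.
Qed.

Hypothesis t0 : forall n, (0 <= t n)%R.

Lemma on_halfline_atomic : on_halfline atomic.
Proof.
move=> x sx; rewrite /= in_itv/= andbT leNgt; apply/negP => x0.
have := sx `]-oo, 0%R[%classic; rewrite atomicE eseries0.
  by rewrite ltxx /= in_itv/= => H; have := H (@interval_open _ -oo%O (BLeft 0%R) isT isT) x0.
move=> n _ _; rewrite diracE memNset ?mule0//= in_itv/=.
by apply/negP; rewrite -leNgt t0.
Qed.

Lemma H_representing_atomic (l : nat -> R) :
  (forall s, has_sum (fun n => w n * t n ^+ s)%R (l s)) ->
  H_representing (fun s => (l s)%:E) atomic.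
Proof.
move=> wl; split=> s; last first.
  rewrite (@integral_atomic_has_sum _ _ (l s))//.
  by move=> n; rewrite exprn_ge0.
rewrite (@integral_atomic_has_sum _ _ (l s)) ?ltry//.
- by apply: measurable_funX; exact: normr_measurable.
- by apply: has_sum_eq (wl s) _ => n; rewrite ger0_norm.
Qed.

End atomic.

Section probability_atomic.
Variables (R : realType) (t w : nat -> R).
Hypotheses (w0 : forall n, 0 <= w n) (w1 : has_sum w 1).

(** The proof arguments serve to attach the structure of a probability to the
    measure. *)
Definition atomic_probability_fun (_ : forall n, 0 <= w n) (_ : has_sum w 1) :
  set R -> \bar R := atomic t w.
Local Notation aprob := (atomic_probability_fun w0 w1).
HB.instance Definition _ := Measure.copy aprob (atomic t w).

Let aprobT : aprob setT = 1%E.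
Proof.
rewrite /atomic_probability_fun atomicE// -(has_sum_nneseries w0 w1).
by apply: eq_eseriesr => n _; rewrite diracT mule1.
Qed.

HB.instance Definition _ := @Measure_isProbability.Build _ _ R aprob aprobT.
Definition atomic_probability : probability R R := aprob.
End probability_atomic.

(** The inverse is continuous on the open set of nonzero reals, and constant on
    its complement. *)
Lemma measurable_invr (R : realType) (D : set R) : measurable_fun D (fun x : R => x^-1).
Proof.
apply: measurable_funTS.
rewrite -(setUv [set 0 : R]); apply/measurable_funU => //.
  exact: measurableC.
split; first exact: measurable_fun_set1.
apply: open_continuous_measurable_fun.
  by rewrite openC; exact: closed_eq.
by move=> x; rewrite inE/= => /eqP x0; exact: inv_continuous.
Qed.

(** * A criterion for determinacy *)

Section determinacy.
Variable R : realType.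
Implicit Types (nu : {measure set R -> \bar R}) (u : nat -> \bar R) (q : {poly R}).
Local Open Scope ereal_scope.

Lemma measurable_horner q (D : set R) : measurable_fun D (fun x => q.[x])%R.
Proof.
under eq_fun do rewrite horner_coef.
by apply: measurable_sum => i; apply: measurable_funM => //; exact: exprn_measurable.
Qed.

Lemma finite_moments_integrable nu (n : nat) : finite_moments nu ->
  nu.-integrable setT (fun t => (t ^+ n)%:E).
Proof.
move=> /(_ n) nun; apply/integrableP; split.
  by apply/measurable_EFinP; exact: exprn_measurable.
by under eq_integral do rewrite /= normrX.
Qed.

Lemma H_representing_poly u nu q : H_representing u nu ->
  \int[nu]_x (q.[x])%:E = \sum_(i < size q) (q`_i)%:E * u i.
Proof.
move=> [fin_nu unu].
under eq_integral do rewrite horner_coef -sumEFin.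
rewrite integral_sum//; last first.
  move=> i; under eq_fun do rewrite EFinM.
  exact/integrableZl/finite_moments_integrable.
apply: eq_bigr => i _; rewrite unu.
under eq_integral do rewrite EFinM.
by rewrite integralZl//; exact: finite_moments_integrable.
Qed.

Lemma measure_le_integral nu (f : R -> R) (B : set R) (c : R) :
  measurable B -> measurable_fun setT f -> (forall x, 0 <= f x)%R -> (0 <= c)%R ->
  (forall x, B x -> c <= f x)%R -> c%:E * nu B <= \int[nu]_x (f x)%:E.
Proof.
move=> mB mf f0 c0 cf; rewrite -integral_cst//.
have mf' : measurable_fun setT (EFin \o f) by exact/measurable_EFinP.
apply: (@le_trans _ _ (\int[nu]_(x in B) (f x)%:E)).
  apply: ge0_le_integral => //.
    exact: measurable_funS mf'.
by apply: ge0_subset_integral => // x _; rewrite lee_fin.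
Qed.

(** Finite measures of equal total mass, one below the other: an inequality on a
    set is compensated on its complement. *)
Lemma measure_eq_of_le nu1 nu2 (A : set R) : measurable A ->
  (forall B, measurable B -> nu1 B <= nu2 B) ->
  nu1 setT = nu2 setT -> nu2 setT < +oo -> nu1 A = nu2 A.
Proof.
move=> mA le12 eq12 fin2.
have mAC : measurable (~` A) by exact: measurableC.
have split_measure nu : nu setT = nu A + nu (~` A).
  by rewrite -(setUv A) measureU// setICr.
have finA : nu2 A < +oo by apply: le_lt_trans fin2; apply: le_measure; rewrite ?inE.
have finAC : nu2 (~` A) < +oo by apply: le_lt_trans fin2; apply: le_measure; rewrite ?inE.
have fn nu B : nu B < +oo -> nu B \is a fin_num by rewrite ge0_fin_numE.
have := eq12; rewrite !split_measure; have := le12 _ mA; have := le12 _ mAC.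
rewrite -(fineK (fn _ _ finA)) -(fineK (fn _ _ finAC)).
rewrite -(fineK (fn _ _ (le_lt_trans (le12 _ mA) finA))).
rewrite -(fineK (fn _ _ (le_lt_trans (le12 _ mAC) finAC))) -!EFinD !lee_fin.
by move=> a b [] c; congr EFin; lra.
Qed.

Variables (t w : nat -> R).
Hypothesis w0 : (forall n, 0 <= w n)%R.
Variable u : nat -> \bar R.
Hypothesis repr_atomic : H_representing u (atomic t w).

Local Notation atoms := (\bigcup_(n in [set n | w n != 0%R]) [set t n]).

Let measurable_atoms : measurable atoms.
Proof. by apply: bigcup_measurable => n _; exact: measurable_set1. Qed.

(** Chebyshev's inequality for the square of a polynomial, whose integral is the
    same for all the representing measures of a sequence. *)
Lemma poly_measure_bound nu q (c : R) (B : set R) : H_representing u nu ->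
  measurable B -> (0 <= c)%R -> (forall x, B x -> c <= q.[x] ^+ 2)%R ->
  c%:E * nu B <= \int[atomic t w]_x (q.[x] ^+ 2)%:E.
Proof.
move=> unu mB c0 cB.
have -> : \int[atomic t w]_x (q.[x] ^+ 2)%:E = \int[nu]_x (q.[x] ^+ 2)%:E.
  under eq_integral do rewrite -horner_exp.
  under [RHS]eq_integral do rewrite -horner_exp.
  by rewrite (H_representing_poly _ repr_atomic) (H_representing_poly _ unu).
apply: measure_le_integral => //; last by move=> x; exact: sqr_ge0.
by apply: measurable_funX; exact: measurable_horner.
Qed.

(** The points where all the q_N^2 are at least 1/(m+1) form a null set for
    each m, by [poly_measure_bound], and these sets cover the complement of the
    atoms. *)
Lemma off_atoms_null nu (q : nat -> {poly R}) (eps : nat -> R) :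
  H_representing u nu ->
  (forall N, \int[atomic t w]_x ((q N).[x] ^+ 2)%:E <= (eps N)%:E) ->
  eps @ \oo --> 0%R ->
  (forall x, (forall n, w n != 0%R -> x != t n) ->
    exists2 d, (0 < d)%R & forall N, (d <= (q N).[x] ^+ 2)%R) ->
  nu (~` atoms) = 0.
Proof.
move=> unu qeps eps0 qx.
pose B (m : nat) := \bigcap_N [set x : R | m.+1%:R^-1 <= (q N).[x] ^+ 2]%R.
have mB m : measurable (B m).
  apply: bigcapT_measurable => N.
  rewrite (_ : [set x | _] =
    (fun x => (q N).[x] ^+ 2)%R @^-1` `[m.+1%:R^-1%R, +oo[%classic); last first.
    by apply/seteqP; split => x /=; rewrite in_itv/= andbT.
  rewrite -[X in measurable X]setTI; apply: measurable_funX => //.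
  exact: measurable_horner.
have B0 m : nu (B m) = 0.
  apply/eqP; rewrite eq_le measure_ge0 andbT.
  rewrite -(@pmule_rle0 _ (m.+1%:R^-1)%:E) ?lte_fin ?invr_gt0//.
  have : forall N, (m.+1%:R^-1)%:E * nu (B m) <= (eps N)%:E.
    move=> N; apply: le_trans (qeps N).
    by apply: poly_measure_bound => // x /(_ N); apply.
  have epsE : EFin \o eps @ \oo --> 0%:E by apply: cvg_EFin => //; exact: nearW.
  move=> le_eps; apply: (cvge_to_ge epsE).
  by near=> N => /=; exact: le_eps.
apply/eqP; rewrite eq_le measure_ge0 andbT.
rewrite -(@eseries0 _ (fun m => nu (B m)) 0 xpredT)//; last first.
apply: measure_sigma_subadditive => //; first exact: measurableC.
move=> x /= xS; have [|d d0 dq] := qx x.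
  move=> n wn; apply/eqP => xtn; apply: xS; exists n => //=.
exists (Num.truncn d^-1) => //= N _ /=; apply: le_trans (dq N).
rewrite invf_ple ?posrE//; apply/ltW; exact: truncnS_gt.
Unshelve. all: end_near. Qed.

(** The polynomials q_N show that a representing measure nu is carried by the
    atoms; the polynomials r, almost extremal for the problem of minimising the
    integral of r^2 subject to r(t_n) = 1, show that nu has at most the mass w_n
    at t_n. Hence nu <= atomic t w, with equal total masses. *)
Lemma H_determinate_atomic (q : nat -> {poly R}) (eps : nat -> R) :
  (forall N, \int[atomic t w]_x ((q N).[x] ^+ 2)%:E <= (eps N)%:E) ->
  eps @ \oo --> 0%R ->
  (forall x, (forall n, w n != 0%R -> x != t n) ->
    exists2 d, (0 < d)%R & forall N, (d <= (q N).[x] ^+ 2)%R) ->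
  (forall n, w n != 0%R -> forall e : R, (0 < e)%R -> exists2 r : {poly R}, r.[t n] != 0%R &
    \int[atomic t w]_x (r.[x] ^+ 2)%:E <= ((w n + e) * r.[t n] ^+ 2)%:E) ->
  H_determinate u.
Proof.
move=> qeps eps0 qx rn.
suff det nu A : H_representing u nu -> measurable A -> nu A = atomic t w A.
  split; first by exists (atomic t w).
  by move=> nu1 nu2 u1 u2 A mA; rewrite (det nu1)// (det nu2).
move=> unu mA; apply: measure_eq_of_le => //; last 2 first.
- have u0 (nu' : {measure set R -> \bar R}) : H_representing u nu' -> nu' setT = u 0%N.
    by move=> [_ ->]; under eq_integral do rewrite expr0; rewrite integral_cst// mul1e.
  by rewrite (u0 _ unu) (u0 _ repr_atomic).
- have [/(_ 0%N) + _] := repr_atomic.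
  by under eq_integral do rewrite expr0; rewrite integral_cst// mul1e.
have atom_le n : w n != 0%R -> nu [set t n] <= (w n)%:E.
  move=> wn; apply/lee_addgt0Pr => e e0.
  have [r rt0 r_le] := rn n wn e e0.
  have r2 : (0 < r.[t n] ^+ 2)%R by rewrite lt_def sqr_ge0 sqrf_eq0 rt0.
  have : (r.[t n] ^+ 2)%:E * nu [set t n] <= ((w n + e) * r.[t n] ^+ 2)%:E.
    apply: le_trans r_le; apply: poly_measure_bound => //; first exact: ltW.
    by move=> x ->.
  by rewrite [leRHS]EFinM [leRHS]muleC lee_pmul2l.
move=> B mB.
have -> : nu B = nu (B `&` atoms).
  rewrite -[in LHS](setUIDK B atoms) measureU//.
  - rewrite [X in _ + X](_ : _ = 0) ?adde0//.
    apply/eqP; rewrite eq_le measure_ge0 andbT -(off_atoms_null unu qeps eps0 qx).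
    apply: le_measure; rewrite ?inE//; first exact: measurableD.
    exact: measurableC.
  - exact: measurableI.
  - exact: measurableD.
  - by rewrite setDE setIACA setICr setI0.
rewrite atomicE//.
apply: (@le_trans _ _ (\sum_(n <oo) nu (B `&` (if w n != 0%R then [set t n] else set0)))).
  apply: measure_sigma_subadditive.
  - move=> n; apply: measurableI => //; case: ifP => // _; exact: measurable_set1.
  - exact: measurableI.
  - by move=> x [Bx [n wn xt]]; exists n => //; split=> //=; rewrite (ifT _ _ wn).
apply: lee_nneseries => // n _; case: ifPn => [wn|_]; last first.
  by rewrite setI0 measure0 mule_ge0 ?lee_fin.
have [Bt|nBt] := pselect (B (t n)).
  rewrite diracE mem_set// mule1; apply: le_trans (atom_le _ wn).
  by apply: le_measure; rewrite ?inE//; exact: measurableI.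
rewrite (_ : B `&` _ = set0) ?measure0 ?mule_ge0 ?lee_fin//.
by apply/seteqP; split => // x [+ xt]; rewrite xt.
Qed.

End determinacy.

(** * Determinacy of the moment sequence at the circuit *)

Section even_polynomials.
Variables (R : realType) (p : R).
Hypotheses (p0 : 0 < p) (p1 : p < 1).
Implicit Types s : pred nat.
Local Notation t := (qpoint p).
Local Notation W := (weight p).

(** The zeros are the points t_(2j+2) with s j: either all of them, or all but
    one when the mass at a single atom is under study. *)
Definition even_poly (s : pred nat) (N : nat) : {poly R} :=
  \prod_(j < N) (1 - ((s j)%:R * p ^+ j.+1.*2) *: 'X).

Lemma horner_even_poly s N x :
  (even_poly s N).[x] = \prod_(j < N) (1 - (s j)%:R * p ^+ j.+1.*2 * x).
Proof.
rewrite horner_prod; apply: eq_bigr => j _.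
by rewrite !hornerE.
Qed.

Lemma even_poly_zero s N k : (k < N)%N -> s k ->
  (even_poly s N).[t k.+1.*2] = 0.
Proof.
move=> kN sk; rewrite horner_even_poly (bigD1 (Ordinal kN))//= sk mul1r pX_qpoint//.
by rewrite subrr mul0r.
Qed.

(** At t_(2k+2) the factor of index j < N <= k is 1 - p^(-2(k-j)), of modulus
    at most p^(-2(k-j)); the missing factors, and those with s j false, only
    make the product smaller. *)
Lemma even_poly_upper s N k : (N <= k)%N ->
  `|(even_poly s N).[t k.+1.*2]| <= \prod_(i < k) p ^- i.+1.*2.
Proof.
move=> Nk; rewrite horner_even_poly normr_prod.
have ge1 m : 1 <= p ^- m by exact: qpoint_ge1.
have -> : \prod_(i < k) p ^- i.+1.*2 = \prod_(0 <= j < k) p ^- (k - j).*2.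
  rewrite big_mkord (reindex_inj rev_ord_inj)/=; apply: eq_bigr => i _.
  by rewrite subnSK.
rewrite -(big_mkord xpredT (fun j => `|1 - (s j)%:R * p ^+ j.+1.*2 * t k.+1.*2|)).
rewrite (@big_cat_nat _ _ _ N 0 k)//= -[leLHS]mulr1; apply: ler_pM.
- exact: prodr_ge0.
- exact: ler01.
- rewrite !big_nat; apply: ler_prod => j /andP[_ jN]; rewrite normr_ge0/=.
  have -> : (s j)%:R * p ^+ j.+1.*2 * t k.+1.*2 = (s j)%:R * p ^- (k - j).*2.
    rewrite -mulrA; congr (_ * _); rewrite /qpoint.
    have -> : k.+1.*2 = ((k - j).*2 + j.+1.*2)%N by lia.
    by rewrite exprD invfM mulrCA divff ?mulr1// pX_neq0.
  have := ge1 (k - j).*2; case: (s j) => /= H.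
    by rewrite mul1r ler0_norm; lra.
  by rewrite mul0r subr0 normr1.
- rewrite big_nat; elim/big_ind : _ => //=.
  by move=> x y x1 y1; rewrite -[1]mulr1 ler_pM.
Qed.

Lemma prod_even_powers (k : nat) :
  (\prod_(i < k.+1.*2) p ^+ i) * (\prod_(i < k) p ^- i.+1.*2) ^+ 2 = p ^+ k.+1.
Proof.
elim: k => [|k IH].
  by rewrite !big_ord_recr !big_ord0 /= expr1n expr0 !mul1r mulr1.
rewrite doubleS 2!big_ord_recr/= [\prod_(i < k.+1) _]big_ord_recr/= -[RHS]/(p * p ^+ k.+1) -IH.
have e1 : p ^+ k.+1.*2.+1 = p * p ^+ k.+1.*2 by rewrite exprS.
rewrite e1; have := pX_neq0 p0 k.+1.*2; move: (p ^+ k.+1.*2) => z z0.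
move: (\prod_(_ < _) _) => a; move: (\prod_(_ < _) _) => b.
by field.
Qed.

(** The growth of Q_N^2 at the atoms is just compensated by the decay of the
    weights: the exponent of p in W_(2k+2) Q_N(t_(2k+2))^2 is at least
    (2k+2)(2k+1)/2 - 2k(k+1) = k+1, uniformly in N <= k. One more zero, at 1,
    would destroy the estimate, in accordance with the indeterminacy of rho. *)
Lemma weight_even_poly : exists2 C, 0 < C & forall s N k, (N <= k)%N ->
  W k.+1.*2 * (even_poly s N).[t k.+1.*2] ^+ 2 <= C * p ^+ k.+1.
Proof.
have [d d0 dP] := pochhammer_lower_bound p0 p1.
exists d^-1; first by rewrite invr_gt0.
move=> s N k Nk; rewrite -prod_even_powers.
have -> : (even_poly s N).[t k.+1.*2] ^+ 2 = `|(even_poly s N).[t k.+1.*2]| ^+ 2.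
  by rewrite real_normK// num_real.
rewrite /weight big_split/= prodfV.
have num0 : 0 <= \prod_(i < k.+1.*2) p ^+ i by apply: prodr_ge0 => i _; rewrite ltW// pX_gt0.
have den0 : 0 < \prod_(i < k.+1.*2) (1 - p ^+ i.+1) by exact: lt_le_trans (dP _).
rewrite [X in X * _]mulrC -mulrA; apply: ler_pM.
- by rewrite invr_ge0 ltW.
- by rewrite mulr_ge0// exprn_ge0.
- by rewrite lef_pV2 ?posrE//; exact: dP.
- rewrite ler_wpM2l// lerXn2r ?nnegrE ?even_poly_upper//.
  by apply: prodr_ge0 => i _; rewrite invr_ge0 ltW// pX_gt0.
Qed.

Lemma even_poly_lower s x : (forall k, s k -> x != t k.+1.*2) ->
  exists2 d, 0 < d & forall N, d <= (even_poly s N).[x] ^+ 2.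
Proof.
move=> sx.
have [||d d0 dP] := @prod1B_lower_bound R p p0 p1 `|x| (fun j => (s j)%:R * p ^+ j.+1.*2 * x).
- move=> j; rewrite mulrC normrM; apply: ler_wpM2l => //.
  rewrite ger0_norm; last by apply: mulr_ge0; [exact: ler0n|rewrite exprn_ge0// ltW].
  apply: (@le_trans _ _ (1 * p ^+ j.+1.*2)).
    by rewrite ler_wpM2r ?(ltW (pX_gt0 _ _))// lern1 leq_b1.
  by rewrite mul1r; apply: ler_wiXn2l; [exact/ltW|exact/ltW|lia].
- move=> j; case: (boolP (s j)) => [sj|_]; last by rewrite !mul0r eq_sym oner_eq0.
  rewrite mul1r; apply/eqP => px; move/negP: (sx j sj); apply; apply/eqP.
  by apply: (mulfI (pX_neq0 p0 j.+1.*2)); rewrite px pX_qpoint.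
exists (d ^+ 2); first by rewrite exprn_gt0.
move=> N; rewrite -[leRHS]real_normK ?num_real// lerXn2r ?nnegrE ?(ltW d0)//.
by rewrite horner_even_poly normr_prod.
Qed.

End even_polynomials.

Section alpha.
Variables (R : realType) (kappa : nat).
Local Notation p := (qratio R kappa).
Local Notation a := (trunk_mass R kappa).
Local Notation t := (qpoint p).
Local Notation W := (weight p).
Let p0 : 0 < p := qratio_gt0 R kappa.
Let p1 : p < 1 := qratio_lt1 R kappa.

(** The measure alpha, normalised. *)
Definition alpha_weight (n : nat) : R := even_term R kappa 0 n / a kappa.

Lemma even_term_ge0 s n : 0 <= even_term R kappa s n.
Proof.
by rewrite mulr_ge0// mulr_ge0 ?exprn_ge0 ?(ltW (qpoint_gt0 _ _))// ltW// weight_gt0.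
Qed.

Lemma alpha_weight_ge0 n : 0 <= alpha_weight n.
Proof. by rewrite divr_ge0 ?even_term_ge0// ltW// trunk_mass_gt0. Qed.

Lemma has_sum_alpha s :
  has_sum (fun n => alpha_weight n * t n ^+ s) (a (s + kappa) / a kappa).
Proof.
rewrite mulrC; apply: has_sum_eq (has_sumZ (@has_sum_even R kappa s)) _ => n.
by rewrite /alpha_weight /even_term; ring.
Qed.

Lemma qpoint_ge0 n : 0 <= t n. Proof. by rewrite ltW// qpoint_gt0. Qed.

Definition trunk_moment (s : nat) : \bar R := (a (s + kappa) / a kappa)%:E.

Lemma H_representing_alpha : H_representing trunk_moment (atomic t alpha_weight).
Proof.
apply: H_representing_atomic; [exact: alpha_weight_ge0|exact: qpoint_ge0|].
by move=> s; exact: has_sum_alpha.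
Qed.

Lemma has_sum_geometric_tail (r : R) N : 0 <= r < 1 ->
  has_sum (fun n => (N <= n)%:R * r ^+ n) (r ^+ N / (1 - r)).
Proof.
move=> r01; elim: N => [|N IH].
  rewrite mul1r; apply: has_sum_eq (has_sum_geometric r01) _ => n.
  by rewrite mul1r.
rewrite exprS -mulrA; apply: has_sum_eq (has_sumZ (has_sum_shift IH)) _.
by case=> [|n] /=; [rewrite mulr0 mul0r|rewrite ltnS exprS mulrCA].
Qed.

(** By [weight_even_poly] the terms of the integral of Q_N^2 are dominated by a
    geometric sequence, and those of rank at most N vanish, except at the atom
    whose factor is left out; so the integral is bounded by the contribution of
    that atom plus the tail of a convergent series. *)
Lemma H_determinate_alpha : H_determinate trunk_moment.
Proof.
have [C C0 CP] := weight_even_poly p0 p1.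
pose D := C / a kappa.
have ak0 : 0 < a kappa by exact: trunk_mass_gt0.
have D0 : 0 < D by rewrite divr_gt0.
(* The k-th atom has index n = 2k, so a bound p^k reads r^n. *)
pose r := Num.sqrt p.
have r0 : 0 < r by rewrite sqrtr_gt0.
have r1 : r < 1 by rewrite -sqrtr1 ltr_sqrt.
have r01 : 0 <= r < 1 by rewrite (ltW r0).
have r2 : r ^+ 2 = p by rewrite sqr_sqrtr// ltW.
have term_bound (s : pred nat) N n : (n = 0%N \/ odd n \/ exists2 k, n = k.+1.*2 & (k < N)%N -> s k) ->
    alpha_weight n * (even_poly p s N).[t n] ^+ 2 <= D * ((N <= n)%:R * r ^+ n).
  have rhs0 m : 0 <= D * ((N <= m)%:R * r ^+ m).
    by rewrite mulr_ge0 ?(ltW D0)// mulr_ge0// exprn_ge0// ltW.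
  case=> [->|[on|[k -> sk]]].
  - by rewrite /alpha_weight /even_term /= !mul0r.
  - by rewrite /alpha_weight /even_term on /= !mul0r.
  have [kN|Nk] := ltnP k N.
    by rewrite even_poly_zero ?sk// expr0n/= mulr0.
  rewrite (_ : (N <= _)%N = true); last by lia.
  rewrite mul1r -mul2n exprM r2 mul2n.
  rewrite /alpha_weight /even_term odd_double/= mul1r expr0 mulr1 /D.
  rewrite mulrAC [leRHS]mulrAC ler_wpM2r ?invr_ge0 ?(ltW ak0)//.
  exact: CP.
have integral_bound (s : pred nat) N (c : R) (n0 : nat) : 0 <= c ->
    (forall n, alpha_weight n * (even_poly p s N).[t n] ^+ 2 <=
       (if n == n0 then c else 0) + D * ((N <= n)%:R * r ^+ n)) ->
    (\int[atomic t alpha_weight]_x ((even_poly p s N).[x] ^+ 2)%:E <=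
      (c + D * (r ^+ N / (1 - r)))%:E)%E.
  move=> c0 le_c.
  have rhs := has_sumD (@has_sum_atom R n0 c) (has_sumZ (c := D) (@has_sum_geometric_tail r N r01)).
  have term0 n : 0 <= alpha_weight n * (even_poly p s N).[t n] ^+ 2.
    by rewrite mulr_ge0 ?alpha_weight_ge0 ?sqr_ge0.
  have [l sl] := has_sum_dominated (fun n => introT andP (conj (term0 n) (le_c n))) rhs.
  rewrite (integral_atomic_has_sum alpha_weight_ge0 _ _ _ _ sl)//.
  - by rewrite lee_fin; apply: has_sum_le le_c sl rhs.
  - by apply: measurable_funX; exact: measurable_horner.
  - by move=> n; exact: sqr_ge0.
have tail0 : (fun N => D * (r ^+ N / (1 - r))) @ \oo --> 0.
  rewrite -[X in _ --> X](mulr0 D); apply: cvgMr.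
  rewrite -[X in _ --> X](mul0r (1 - r)^-1); apply: cvgMl.
  by apply: cvg_expr; rewrite ger0_norm// ltW.
have parity n : n = 0%N \/ odd n \/ exists k, n = k.+1.*2.
  have [on|en] := boolP (odd n); first by right; left.
  case: n en => [|n]; first by left.
  by move=> en; right; right; exists (n./2); lia.
apply: (H_determinate_atomic alpha_weight_ge0 H_representing_alpha
  (q := even_poly p xpredT) (eps := fun N => D * (r ^+ N / (1 - r)))) => //.
- move=> N; rewrite -[X in (_ <= X%:E)%E]add0r.
  apply: (@integral_bound _ _ 0 0%N) => // n.
  rewrite if_same add0r; apply: term_bound.
  by have [->|[on|[k ->]]] := parity n; [left|right; left|right; right; exists k].
- move=> x xt; apply: even_poly_lower => // k _; apply: xt.
  rewrite /alpha_weight /even_term odd_double/= mul1r expr0 mulr1.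
  by rewrite mulf_neq0 ?invr_eq0 ?gt_eqF// weight_gt0.
- move=> n wn e e0.
  have [nE|[on|[k nE]]] := parity n.
  + by move: wn; rewrite nE /alpha_weight /even_term /= !mul0r eqxx.
  + by move: wn; rewrite /alpha_weight /even_term on /= !mul0r eqxx.
  have [|d d0 dP] := @even_poly_lower R p p0 p1 (predC1 k) (t n).
    move=> j /=; rewrite nE; apply: contraNneq => /(qpoint_inj p0 p1) H.
    by apply/eqP; lia.
  have ed0 : 0 < e * d by rewrite mulr_gt0.
  have /cvgrPdist_le /(_ _ ed0)[N _ /(_ N (leqnn N)) /=] := tail0.
  rewrite sub0r normrN => /(le_trans (ler_norm _)) Ned.
  exists (even_poly p (predC1 k) N).
    by rewrite -sqrf_eq0 gt_eqF// (lt_le_trans d0).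
  apply: le_trans (@integral_bound _ N (alpha_weight n * (even_poly p (predC1 k) N).[t n] ^+ 2) n _ _) _.
  + by rewrite mulr_ge0 ?alpha_weight_ge0 ?sqr_ge0.
  + move=> m; case: eqVneq => [->|mn].
      rewrite lerDl mulr_ge0 ?(ltW D0)// mulr_ge0// exprn_ge0// ltW//.
    rewrite add0r; apply: term_bound.
    have [->|[om|[j mE]]] := parity m; [by left|by right; left|right; right].
    exists j => // _ /=; apply: contra_neq mn => jk; by rewrite mE nE jk.
  + rewrite lee_fin mulrDl lerD2l; apply: (le_trans Ned).
    by rewrite ler_wpM2l// ltW.
Qed.

End alpha.

(** * Indeterminacy: index at the circuit, moment sequences on the branch *)

Section atomic_values.
Variables (R : realType) (t w : nat -> R).
Hypothesis w0 : forall n, 0 <= w n.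
Local Open Scope ereal_scope.

Lemma atomic_set1 n : injective t -> atomic t w [set t n] = (w n)%:E.
Proof.
move=> t_inj; rewrite atomicE//.
rewrite -(has_sum_nneseries _ (@has_sum_atom R n (w n))); last by move=> k; case: ifP.
apply: eq_eseriesr => k _; rewrite diracE; case: eqVneq => [->|kn].
  by rewrite mem_set// mule1.
by rewrite memNset ?mule0//= => /t_inj/eqP; rewrite (negbTE kn).
Qed.

Lemma atomic_disjoint A : (forall n, A (t n) -> w n = 0%R) -> atomic t w A = 0.
Proof.
move=> Aw; rewrite atomicE// eseries0// => n _ _.
have [At|nAt] := pselect (A (t n)); first by rewrite Aw// mul0e.
by rewrite diracE memNset// mule0.
Qed.

Lemma weighted_atomic (k : nat) A : measurable A ->
  weighted_measure (atomic t w) 0%R k A = atomic t (fun n => w n * t n ^+ (2 * k))%R A.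
Proof.
have wt0 n : (0 <= w n * t n ^+ (2 * k))%R by rewrite mulr_ge0// exprM exprn_ge0// sqr_ge0.
move=> mA; rewrite /weighted_measure.
have cabsE (x : R) : (cabs (x%:C%C - 0) ^+ (2 * k) = x ^+ (2 * k))%R.
  by rewrite subr0 !exprM cabs2E/= expr0n/= addr0.
under eq_integral do rewrite cabsE.
rewrite (integral_atomic w0)//.
- rewrite atomicE//; apply: eq_eseriesr => n _; by rewrite EFinM [in RHS]muleAC muleA.
- by apply/measurable_EFinP; exact: exprn_measurable.
- by move=> n; rewrite lee_fin exprM exprn_ge0// sqr_ge0.
Qed.

End atomic_values.

Lemma eq_H_representing (R : realType) (u : nat -> \bar R) (m1 m2 : {measure set R -> \bar R}) :
  (forall A, measurable A -> m1 A = m2 A) -> H_representing u m1 -> H_representing u m2.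
Proof.
move=> m12 [fin1 u1].
have e12 f : (\int[m1]_x f x = \int[m2]_x f x)%E.
  by apply: eq_measure_integral => A mA _; exact: m12.
by split=> n; rewrite -e12// u1.
Qed.

Section circuit_moments.
Variables (R : realType) (kappa : nat).
Local Notation p := (qratio R kappa).
Local Notation a := (trunk_mass R kappa).
Local Notation t := (qpoint p).
Local Notation W := (weight p).
Local Notation b := (branch_mass R kappa).
Let p0 : 0 < p := qratio_gt0 R kappa.
Let p1 : p < 1 := qratio_lt1 R kappa.
Let t_gt0 n : 0 < t n := qpoint_gt0 p0 n.
Let t_neq0 n : t n != 0. Proof. by rewrite gt_eqF. Qed.
Let tX_gt0 n s : 0 < t n ^+ s. Proof. exact: exprn_gt0. Qed.
Let tX_neq0 n s : t n ^+ s != 0. Proof. by rewrite gt_eqF. Qed.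
Let a_gt0 s : 0 < a s := trunk_mass_gt0 R kappa s.
Let b_gt0 j : 0 < b j := branch_mass_gt0 R kappa j.
Let W_gt0 n : 0 < W n := weight_gt0 p0 p1 n.

(** The weights, before normalisation, of t^(2k+2) alpha - (t-1) t^(2k+1) eta.
    At even n >= 2 this leaves t^(2k+1) and at n = 0 nothing. *)
Definition alpha_alt_term (k n : nat) : R :=
  even_term R kappa k.*2.+1 n +
  (trunk_term R kappa (k.*2.+2 + kappa) n - trunk_term R kappa (k.*2.+1 + kappa) n).

Let odd_diffE s n : trunk_term R kappa (s.+1 + kappa) n - trunk_term R kappa (s + kappa) n =
  (odd n)%:R * (W n * t n ^+ s * (t n - 1)).
Proof. by rewrite /trunk_term !exprD exprS; field; exact: tX_neq0. Qed.

Let odd_diff_ge0 s n : 0 <= (odd n)%:R * (W n * t n ^+ s * (t n - 1)).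
Proof.
rewrite mulr_ge0// mulr_ge0 ?subr_ge0 ?(qpoint_ge1 p0 p1)//.
by rewrite mulr_ge0 ?(ltW (tX_gt0 _ _)) ?(ltW (W_gt0 _)).
Qed.

(** Order k = 0 is the determinacy of alpha. For order k + 1 the measure with
    weights [alpha_alt_term] has the same moments and charges t_1, which is not an
    atom of alpha. *)
Lemma H_index_alpha : H_index 0 (atomic t (alpha_weight R kappa)) = 0%E.
Proof.
pose w k n := alpha_weight R kappa n * t n ^+ (2 * k).
have w0 k n : 0 <= w k n by rewrite mulr_ge0 ?alpha_weight_ge0// ltW.
pose u k s : \bar R := (a (2 * k + s + kappa) / a kappa)%:E.
have w_rep k : H_representing (u k) (atomic t (w k)).
  apply: H_representing_atomic; [exact: w0|by move=> n; exact: ltW|].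
  move=> s; apply: has_sum_eq (@has_sum_alpha R kappa (2 * k + s)) _ => n.
  by rewrite /w exprD mulrA.
have weighted_rep k : H_representing (u k)
    (weighted_measure (atomic t (alpha_weight R kappa)) 0 k).
  apply: eq_H_representing (w_rep k) => A mA.
  by rewrite /= weighted_atomic//; exact: alpha_weight_ge0.
have momE k : (fun n => \int[weighted_measure (atomic t (alpha_weight R kappa)) 0%R k]_x
    (x ^+ n)%:E)%E = u k.
  by have [_ /(_ _)/esym] := weighted_rep k; move=> H; apply/funext.
rewrite /H_index; apply/eqP; rewrite eq_le; apply/andP; split; last first.
  apply: ereal_sup_ubound; exists 0%N => //=; split.
    by have [] := weighted_rep 0%N.
  by rewrite momE; exact: H_determinate_alpha.
apply: ge_ereal_sup => _ [[|k] [_ +] <-]; first by [].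
rewrite momE => -[_ det]; exfalso.
pose v n := alpha_alt_term k n / a kappa.
have v0 n : 0 <= v n.
  by rewrite divr_ge0 ?(ltW (a_gt0 _))// /alpha_alt_term odd_diffE addr_ge0 ?even_term_ge0.
have v_rep : H_representing (u k.+1) (atomic t v).
  apply: H_representing_atomic => // [n|s]; first exact: ltW.
  have := has_sumD (@has_sum_even R kappa (k.*2.+1 + s))
    (has_sumB (@has_sum_trunk R kappa (k.*2.+2 + s + kappa))
              (@has_sum_trunk R kappa (k.*2.+1 + s + kappa))).
  move=> /(has_sumZ (c := (a kappa)^-1)).
  have -> : (a kappa)^-1 * (a (k.*2.+1 + s + kappa) +
      (a (k.*2.+2 + s + kappa) + 1 - (a (k.*2.+1 + s + kappa) + 1))) =
      a (k.*2.+2 + s + kappa) / a kappa by ring.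
  move=> H; rewrite mul2n doubleS; move: H => /has_sum_eq; apply => n.
  rewrite -[(k.*2.+2 + s)%N]/((k.*2.+1 + s).+1) /v /alpha_alt_term /even_term !odd_diffE !exprD.
  by ring.
have := det _ _ (w_rep k.+1) v_rep [set t 1] (measurable_set1 _).
rewrite !atomic_set1 //; try exact: (qpoint_inj p0 p1).
rewrite /w /alpha_weight /even_term /= !mul0r => -[] /eqP.
rewrite eq_sym gt_eqF// /v divr_gt0// /alpha_alt_term odd_diffE /even_term /=.
rewrite mul0r add0r mul1r mulr_gt0 ?subr_gt0 ?qpoint_gt1//.
by rewrite mulr_gt0.
Qed.

Definition branch_moment (j s : nat) : \bar R := (b (j + s) / b j)%:E.

(** The measure t^j nu, normalised. *)
Definition branch_weight j n : R := branch_term R kappa j n / b j.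

Lemma branch_weight_ge0 j n : 0 <= branch_weight j n.
Proof. by rewrite divr_ge0 ?branch_term_ge0// ltW. Qed.

Lemma has_sum_branch_weight j s :
  has_sum (fun n => branch_weight j n * t n ^+ s) (b (j + s) / b j).
Proof.
rewrite mulrC; apply: has_sum_eq (has_sumZ (@has_sum_branch R kappa (j + s))) _ => n.
by rewrite /branch_weight /branch_term exprD; ring.
Qed.

Lemma S_representing_branch j :
  S_representing (branch_moment j) (atomic t (branch_weight j)).
Proof.
split; last first.
  by apply: on_halfline_atomic => n; [exact: branch_weight_ge0|exact: ltW].
apply: H_representing_atomic; [exact: branch_weight_ge0|by move=> n; exact: ltW|].
by move=> s; exact: has_sum_branch_weight.
Qed.

(** The weights of t^j nu + t^j (t-1) eta: the sum is positive because the
    negative part W_n (t-1) of (t-1) eta at odd n is at most the mass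
    W_n (t - t^(-kappa)) of nu. *)
Definition branch_alt_term j n : R :=
  (even_term R kappa j.+1 n - even_term R kappa j n) +
  (trunk_term R kappa (j + kappa) n - trunk_term R kappa j n).

Lemma branch_alt_termE j n : branch_alt_term j n =
  (~~ odd n && (n != 0))%:R * (W n * t n ^+ j * (t n - 1)) +
  (odd n)%:R * (W n * t n ^+ j * (1 - t n ^- kappa)).
Proof.
rewrite /branch_alt_term /even_term /trunk_term exprD exprS.
by field; exact: tX_neq0.
Qed.

Lemma S_indeterminate_branch j : S_indeterminate (branch_moment j).
Proof.
have rep := S_representing_branch j.
split; first by exists (atomic t (branch_weight j)).
move=> [_ det].
pose v n := branch_alt_term j n / b j.
have v0 n : 0 <= v n.
  have t1 : 1 <= t n ^+ kappa by rewrite exprn_ege1// qpoint_ge1.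
  rewrite divr_ge0 ?(ltW (b_gt0 _))// branch_alt_termE addr_ge0// mulr_ge0// mulr_ge0
    ?subr_ge0 ?(qpoint_ge1 p0 p1)//.
  - by rewrite mulr_ge0 ?(ltW (tX_gt0 _ _)) ?(ltW (W_gt0 _)).
  - by rewrite mulr_ge0 ?(ltW (tX_gt0 _ _)) ?(ltW (W_gt0 _)).
  - by rewrite invf_le1.
have v_rep : S_representing (branch_moment j) (atomic t v).
  split; last by apply: on_halfline_atomic => // n; exact: ltW.
  apply: H_representing_atomic => // [n|s]; first exact: ltW.
  have := has_sumD (has_sumB (@has_sum_even R kappa (j + s).+1) (@has_sum_even R kappa (j + s)))
    (has_sumB (@has_sum_trunk R kappa (j + s + kappa)) (@has_sum_trunk R kappa (j + s))).
  move=> /(has_sumZ (c := (b j)^-1)).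
  have -> : (b j)^-1 * (a ((j + s).+1 + kappa) - a (j + s + kappa) +
      (a (j + s + kappa) + 1 - (a (j + s) + 1))) = b (j + s) / b j.
    have -> : b (j + s) = a ((j + s).+1 + kappa) - a (j + s) by rewrite /branch_mass addSnnS.
    by ring.
  move=> H; apply: has_sum_eq H _ => n.
  rewrite -/(branch_alt_term (j + s) n) branch_alt_termE /v branch_alt_termE exprD; ring.
have := det _ _ rep v_rep [set t 2] (measurable_set1 _).
rewrite !atomic_set1 //; try exact: (qpoint_inj p0 p1); last exact: branch_weight_ge0.
rewrite /branch_weight /branch_term /= !mul0r => -[] /eqP.
rewrite eq_sym gt_eqF// /v divr_gt0// branch_alt_termE /= mul0r addr0 mul1r.
by rewrite mulr_gt0 ?subr_gt0 ?qpoint_gt1// mulr_gt0.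
Qed.

Lemma has_sum_branch_weight1 j : has_sum (branch_weight j) 1.
Proof.
have := @has_sum_branch_weight j 0; rewrite addn0 divff ?gt_eqF// => H.
by apply: has_sum_eq H _ => n; rewrite expr0 mulr1.
Qed.

Definition branch_probability : probability R R :=
  atomic_probability t (branch_weight_ge0 0) (@has_sum_branch_weight1 0).

Lemma branch_probability01 : branch_probability `[0, 1]%classic = 0%E.
Proof.
apply: atomic_disjoint; first exact: branch_weight_ge0.
case=> [|n] /=; rewrite in_itv/=.
  by rewrite /branch_weight /branch_term /= !mul0r.
by move=> /andP[_]; rewrite leNgt qpoint_gt1.
Qed.

(** The weight t - t^(-kappa) = (t^(kappa+1) - 1) t^(-kappa) of nu cancels the
    denominator. At t_0 = 1, where the denominator vanishes, there is no mass. *)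
Lemma integral_branch_probability r :
  (\int[branch_probability]_(x in `[0%R, +oo[%classic)
     ((x ^+ r - 1) / (x ^+ kappa.+1 - 1))%:E = ((a r - a 0%N) / b 0%N)%:E)%E.
Proof.
have quot_meas : measurable_fun (`[0%R, +oo[%classic : set R)
    (fun x : R => (x ^+ r - 1) / (x ^+ kappa.+1 - 1)).
  apply: measurable_funM; first by apply: measurable_funB => //; exact: exprn_measurable.
  apply: (measurableT_comp (measurable_invr (D := setT))).
  by apply: measurable_funB => //; exact: exprn_measurable.
apply: integral_atomic_has_sum => //; first exact: branch_weight_ge0.
- by move=> n; rewrite /= in_itv/= andbT ltW.
- by move=> n; rewrite divr_ge0// subr_ge0 exprn_ege1// qpoint_ge1.
have := has_sumB (@has_sum_trunk R kappa r) (@has_sum_trunk R kappa 0).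
move=> /(has_sumZ (c := (b 0%N)^-1)).
have -> : (b 0%N)^-1 * (a r + 1 - (a 0%N + 1)) = (a r - a 0%N) / b 0%N by ring.
move=> H; apply: has_sum_eq H _ => n.
rewrite /trunk_term /branch_weight /branch_term.
case: n => [|n] /=; first by rewrite !mul0r subrr mulr0.
have tk1 : t n.+1 ^+ kappa.+1 - 1 != 0.
  by rewrite subr_eq0 gt_eqF// exprn_egt1// qpoint_gt1.
rewrite exprS in tk1 *; have tk0 := tX_neq0 n.+1 kappa; have b0 := lt0r_neq0 (b_gt0 0).
by field; rewrite tk0 b0 tk1.
Qed.

Lemma integral_branch_probability_inv :
  (\int[branch_probability]_(x in `[0%R, +oo[%classic)
     ((x ^+ kappa.+1 - 1)^-1)%:E = ((a 0%N + 1) / b 0%N)%:E)%E.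
Proof.
have inv_meas : measurable_fun (`[0%R, +oo[%classic : set R) (fun x : R => (x ^+ kappa.+1 - 1)^-1).
  apply: (measurableT_comp (measurable_invr (D := setT))).
  by apply: measurable_funB => //; exact: exprn_measurable.
apply: integral_atomic_has_sum => //; first exact: branch_weight_ge0.
- by move=> n; rewrite /= in_itv/= andbT ltW.
- by move=> n; rewrite invr_ge0// subr_ge0 exprn_ege1// qpoint_ge1.
have := @has_sum_trunk R kappa 0.
move=> /(has_sumZ (c := (b 0%N)^-1)); rewrite [X in has_sum _ X]mulrC => H.
apply: has_sum_eq H _ => n.
rewrite /trunk_term /branch_weight /branch_term.
case: n => [|n] /=; first by rewrite !mul0r mulr0.
have tk1 : t n.+1 ^+ kappa.+1 - 1 != 0.
  by rewrite subr_eq0 gt_eqF// exprn_egt1// qpoint_gt1.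
rewrite exprS in tk1 *; have tk0 := tX_neq0 n.+1 kappa; have b0 := lt0r_neq0 (b_gt0 0).
by field; rewrite tk0 b0 tk1.
Qed.

End circuit_moments.

(** * Square-integrable functions on a countable discrete space *)

Section point_masses.
Local Open Scope complex_scope.
Variables (T : pointedType) (R : realType) (m : T -> R).
Local Open Scope ereal_scope.

(** All subsets are measurable, so a family of point masses is summed over
    arbitrary subsets; the absolute value plays the same part as in
    [atomic]. *)
Definition point_masses (A : set (powerset_space T)) : \bar R :=
  \esum_(x in A) `|m x|%:E.

Let point_masses0 : point_masses set0 = 0.
Proof. exact: esum_set0. Qed.

Let point_masses_ge0 A : 0 <= point_masses A.
Proof. by apply: esum_ge0 => x _; rewrite lee_fin. Qed.

Let point_masses_additive : semi_sigma_additive point_masses.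
Proof.
move=> F mF tF mUF; rewrite /point_masses esum_bigcupT//; last first.
rewrite -nneseries_esumT//; last by move=> n; exact: point_masses_ge0.
by apply: is_cvg_ereal_nneg_natsum_cond => // n _ _; exact: point_masses_ge0.
Qed.

HB.instance Definition _ := isMeasure.Build _ (powerset_space T) R point_masses
  point_masses0 point_masses_ge0 point_masses_additive.

Hypothesis m_gt0 : forall x, (0 < m x)%R.
Variable code : T -> nat.
Hypothesis code_inj : injective code.

Lemma point_masses1 x : point_masses [set x] = (m x)%:E.
Proof. by rewrite /point_masses esum_set1 ?lee_fin// gtr0_norm. Qed.

Lemma point_masses_sigma_finite : sigma_finite [set: powerset_space T] point_masses.
Proof.
exists (fun n => code @^-1` [set n]); first by apply/seteqP; split => // x _; exists (code x).
move=> n; split => //.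
have [[x xn]|nx] := pselect (exists x, code x = n).
  rewrite (_ : _ @^-1` _ = [set x]) ?point_masses1 ?ltry//.
  by apply/seteqP; split => [y /= yn|y ->//]; apply: code_inj; rewrite yn.
rewrite (_ : _ @^-1` _ = set0) ?measure0//.
by apply/seteqP; split => // y /= yn; apply: nx; exists y.
Qed.

Lemma point_masses_gt0 x : 0 < point_masses [set x].
Proof. by rewrite point_masses1 lte_fin. Qed.

Definition discrete_of_masses : discreteMeasure T R :=
  DiscreteMeasure point_masses_sigma_finite point_masses_gt0.

End point_masses.

Section countable_integral.
Local Open Scope complex_scope.
Variables (T : pointedType) (R : realType) (code : T -> nat).
Hypothesis code_inj : injective code.
Variable mu : {measure set (powerset_space T) -> \bar R}.
Local Open Scope ereal_scope.

Lemma integral_point (f : T -> \bar R) x :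
  \int[mu]_(y in [set x]) f y = f x * mu [set x].
Proof.
rewrite -integral_cst//; apply: eq_integral => y; rewrite inE/= => ->//.
Qed.

(** The fibers of an injective coding into the natural numbers partition the
    space into countably many sets with at most one point. *)
Lemma integral_countable (f : T -> \bar R) : (forall x, 0 <= f x) ->
  \int[mu]_x f x = \esum_(x in [set: T]) f x * mu [set x].
Proof.
move=> f0; pose F n := code @^-1` [set n].
have FT : [set: T] = \bigcup_n F n by apply/seteqP; split => // x _; exists (code x).
have tF : trivIset setT F by move=> i j _ _ [x [<- <-]].
rewrite FT (@ge0_integral_bigcup _ (powerset_space T) R mu F)//.
rewrite esum_bigcupT//; last by move=> x; rewrite mule_ge0.
rewrite -nneseries_esumT; last by move=> n; apply: esum_ge0 => x _; rewrite mule_ge0.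
apply: eq_eseriesr => n _.
have [[x xn]|nx] := pselect (exists x, code x = n).
  have -> : F n = [set x].
    by apply/seteqP; split => [y /= yn|y ->//]; apply: code_inj; rewrite yn.
  by rewrite integral_point esum_set1// mule_ge0.
have -> : F n = set0 by apply/seteqP; split => // y /= yn; apply: nx; exists y.
by rewrite integral_set0 esum_set0.
Qed.

End countable_integral.

Section L2_topology.
Local Open Scope complex_scope.
Variables (T : pointedType) (R : realType) (mu : discreteMeasure T R).
Implicit Types (f g : L2 mu).

Lemma L2_norm_sqr f : `|f| ^+ 2 = (fine (\int[mu]_x (cabs (f x) ^+ 2)%:E))%:C :> R[i].
Proof. by rewrite normr_inner L2_innerE L2_inner_norm. Qed.

Lemma L2_integral_fin f : (\int[mu]_x (cabs (f x) ^+ 2)%:E)%E \is a fin_num.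
Proof.
rewrite ge0_fin_numE ?L2_finite//; apply: integral_ge0 => x _.
by rewrite lee_fin sqr_ge0.
Qed.

Lemma L2_norm_le f (r : R) : 0 <= r ->
  (`|f| <= r%:C) = (\int[mu]_x (cabs (f x) ^+ 2)%:E <= (r ^+ 2)%:E)%E.
Proof.
move=> r0; rewrite -(fineK (L2_integral_fin f)) lee_fin -[RHS]lecR rmorphXn/=.
rewrite -L2_norm_sqr ler_pXn2r// nnegrE; last by rewrite ler0c.
exact: normr_ge0.
Qed.

Definition mass (x : T) : R := fine (mu [set x]).

Lemma massE x : mu [set x] = (mass x)%:E.
Proof. by rewrite /mass fineK// discrete_fin_num. Qed.

Lemma mass_gt0 x : 0 < mass x.
Proof. by rewrite -lte_fin -massE discrete_gt0. Qed.

Lemma L2_eval_le f (r : R) x : 0 <= r -> `|f| <= r%:C ->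
  cabs (f x) ^+ 2 <= r ^+ 2 / mass x.
Proof.
move=> r0; rewrite L2_norm_le// => /(le_trans (L2_point_le f x)).
by rewrite massE -EFinM lee_fin ler_pdivlMr ?mass_gt0.
Qed.

(** Point evaluations are continuous on L2, since the value at x is controlled
    by the norm through the mass of x; so the equations g x = f (phi x) pass to
    limits. *)
Lemma composition_closed (phi : T -> T) : closed (composition_operator mu phi).
Proof.
move=> [f g] fg /= x; apply/eqP; rewrite -subr_eq0 -cabs_eq0; apply/negP => /negP d0.
pose d := cabs (g x - f (phi x)).
have dpos : 0 < d ^+ 2 by rewrite exprn_gt0// lt_def d0 cabs_ge0.
pose c := (mass x)^-1 + (mass (phi x))^-1.
have c0 : 0 < c by rewrite addr_gt0// invr_gt0 mass_gt0.
(* With this radius the errors of the two evaluations add up to at most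
   d^2 / 2, against d^2. *)
pose r := Num.sqrt (d ^+ 2 / (4 * c)).
have r20 : 0 < d ^+ 2 / (4 * c) by rewrite divr_gt0// mulr_gt0.
have r0 : 0 < r by rewrite sqrtr_gt0.
have rC : 0 < r%:C :> R[i] by rewrite ltcR.
have [[f' g'] /= [fg' [bf bg]]] :
    (composition_operator mu phi `&` (ball f r%:C `*` ball g r%:C)) !=set0.
  apply: fg; exists (ball f r%:C, ball g r%:C) => //=.
  by split; exact: nbhsx_ballx.
have eval_lt (u v : L2 mu) y : ball u r%:C v -> cabs (u y - v y) ^+ 2 <= r ^+ 2 / mass y.
  rewrite -ball_normE/= => uv.
  by apply: (@L2_eval_le (u - v) r y (ltW r0)); exact: ltW.
have := cabs2D (g x - g' x) (f' (phi x) - f (phi x)).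
rewrite (fg' x) addrA subrK -/d.
have := eval_lt _ _ x bg; rewrite /= (fg' x).
have := eval_lt _ _ (phi x) bf.
have -> : cabs (f (phi x) - f' (phi x)) = cabs (f' (phi x) - f (phi x)).
  by rewrite /cabs distrC.
rewrite sqr_sqrtr ?(ltW r20)//.
move: (cabs _ ^+ 2) (cabs _ ^+ 2) => A B le1 le2 le3.
have : 2 * A + 2 * B <= d ^+ 2 / 2.
  have -> : d ^+ 2 / 2 = 2 * (d ^+ 2 / (4 * c) / mass (phi x)) + 2 * (d ^+ 2 / (4 * c) / mass x).
    rewrite -mulrDr -mulrDr [(mass _)^-1 + _]addrC -/c.
    by have c_neq0 := lt0r_neq0 c0; field.
  lra.
lra.
Qed.

Variable code : T -> nat.
Hypothesis code_inj : injective code.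

(** Dominated convergence of the truncations to finite sets. *)
Lemma L2_ball_approx f (e : R) (S : nat -> T -> R[i]) : 0 < e ->
  (forall n x, S n x = if (code x < n)%N then f x else 0) ->
  (forall n, S n \in l2 mu) ->
  exists2 g : L2 mu, ball f e%:C g & exists n, L2_fun g = S n.
Proof.
move=> e0 SE Sl2.
pose F n (x : powerset_space T) := (cabs (f x - S n x) ^+ 2)%:E.
have [_ _ cv] : [/\ mu.-integrable setT (cst 0%E : powerset_space T -> \bar R),
  [sequence \int[mu]_x `|F n x - 0|]_n%E @ \oo --> 0%E &
  [sequence \int[mu]_x F n x]_n%E @ \oo --> (\int[mu]_x 0)%E].
  apply: (@dominated_convergence _ _ _ mu setT measurableT F (cst 0%E)
    (fun x => (cabs (f x) ^+ 2)%:E)) => //.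
  - apply/aeW => x _; apply: cvg_near_cst; exists (code x).+1 => // n /= xn.
    by rewrite /F SE xn subrr cabs2E/= expr0n/= addr0.
  - apply/integrableP; split => //.
    under eq_integral do rewrite gee0_abs ?lee_fin ?sqr_ge0//.
    exact: L2_finite.
  - apply/aeW => x n _; rewrite gee0_abs ?lee_fin ?sqr_ge0// /F SE.
    by case: ifP => _; rewrite ?subr0// subrr cabs2E/= expr0n/= addr0 sqr_ge0.
move: cv; rewrite integral0 => /fine_cvgP[[N1 _ fin1]].
move=> /cvgrPdist_le /(_ ((e / 2) ^+ 2)).
case; first by rewrite exprn_gt0// divr_gt0.
move=> N2 _ N2le; pose n := maxn N1 N2.
exists (MkL2 (Sl2 n)); last by exists n.
rewrite -ball_normE/=.
apply: (@le_lt_trans _ _ (e / 2)%:C); last by rewrite ltcR ltr_pdivrMr// ltr_pMr// ltr1n.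
rewrite L2_norm_le ?divr_ge0 ?(ltW e0)//.
have := N2le n (leq_maxr _ _); rewrite /= sub0r normrN => /(le_trans (ler_norm _)).
rewrite -lee_fin fineK; last exact: (fin1 n (leq_maxl _ _)).
exact.
Qed.

Lemma fin_supp_l2 (phi : T -> T) (f : T -> R[i]) :
  (forall x, (mu (phi @^-1` [set x]) < +oo)%E) ->
  forall n, (fun x => if (code (phi x) < n)%N then f (phi x) else 0) \in l2 mu.
Proof.
move=> finphi; elim=> [|n IH]; first by rewrite (_ : (fun _ => _) = 0) ?rpred0//.
have [[y yn]|ny] := pselect (exists y, code y = n); last first.
  rewrite (_ : (fun x => _) = (fun x => if (code (phi x) < n)%N then f (phi x) else 0))//.
  apply/funext => x; rewrite ltnS leq_eqVlt; case: eqVneq => //= xn.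
  by exfalso; apply: ny; exists (phi x).
rewrite (_ : (fun x => _) = (fun x => if (code (phi x) < n)%N then f (phi x) else 0) +
  f y *: ((fun x => (phi x == y)%:R) : T -> R[i])); last first.
  apply/funext => x; rewrite [RHS]/GRing.add/= /GRing.scale/= ltnS leq_eqVlt -yn.
  have [->|xy] := eqVneq (phi x) y; first by rewrite ltnn eqxx/= add0r [RHS]mulr1.
  by rewrite (inj_eq code_inj) (negbTE xy)/= [_ *: _]mulr0 addr0.
apply: rpredD => //; apply: rpredZ; rewrite inE/=.
apply: (@le_lt_trans _ _ (\int[mu]_(x in phi @^-1` [set y]) 1)%E); last first.
  by rewrite integral_cst// mul1e.
rewrite [leRHS]integral_mkcond; apply: ge0_le_integral => //.
- by move=> x _; rewrite lee_fin sqr_ge0.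
- move=> x _; rewrite /patch; case: eqVneq => [xy|xy].
    by rewrite mem_set//= cabs2E/= expr0n/= addr0 expr1n.
  rewrite memNset/=; last by move=> /eqP; rewrite (negbTE xy).
  by rewrite cabs2E/= expr0n/= addr0.
Qed.

(** A function with finite support composed with an iterate of phi is a
    combination of indicators of preimages of points, which have finite
    measure; so functions with finite support belong to the domains of all the
    powers. *)
Lemma op_dom_infty_dense (phi : T -> T) :
  (forall n x, (mu (iter n phi @^-1` [set x]) < +oo)%E) ->
  dense (op_dom_infty (composition_operator mu phi)).
Proof.
move=> finphi O [f Of] oO.
have [_/posnumP[e] fe] : exists2 e : R[i], 0 < e & ball f e `<=` O.
  by apply/nbhs_ballP; apply: open_nbhs_nbhs.
have [r r0 er] := gt0_complexP [gt0 of e%:num].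
pose S n (x : T) : R[i] := if (code x < n)%N then f x else 0.
have [g fg [n gS]] := @L2_ball_approx f r S r0 (fun _ _ => erefl)
  (@fin_supp_l2 id f (finphi 0%N)).
exists g; split; first by apply: fe; rewrite er.
move=> k _.
have Sl2 i : (S n \o iter i phi) \in l2 mu by exact: (fin_supp_l2 f (finphi i) n).
exists (g, MkL2 (Sl2 k)) => //.
elim: k => [|k IH].
  by rewrite /op_pow/=; apply: val_inj; rewrite /= gS.
by exists (MkL2 (Sl2 k)) => // x /=; rewrite -iterSr.
Qed.

Lemma op_dom_dense (phi : T -> T) :
  (forall n x, (mu (iter n phi @^-1` [set x]) < +oo)%E) ->
  dense (op_dom (composition_operator mu phi)).
Proof.
move=> finphi O O0 oO; have [f [Of fdom]] := op_dom_infty_dense finphi O0 oO.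
exists f; split => //; have [[f1 f2] /= [y fy yf2] <-] := fdom 1%N I.
by exists (f1, f2) => //; move: fy; rewrite /= => <-.
Qed.

End L2_topology.

(** * Normal and subnormal composition operators *)

Section bijective_composition.
Local Open Scope complex_scope.
Variables (T : pointedType) (R : realType) (mu : discreteMeasure T R).
Variable code : T -> nat.
Hypothesis code_inj : injective code.
Variables (phi psi : T -> T) (c : T -> R).
Hypotheses (phiK : cancel phi psi) (psiK : cancel psi phi).
Hypothesis mass_psi : forall x, mass mu (psi x) = c x * mass mu x.
Hypothesis c_phi : forall x, c (phi x) = c x.

Let c_gt0 x : 0 < c x.
Proof. by rewrite -(pmulr_lgt0 _ (mass_gt0 mu x)) -mass_psi mass_gt0. Qed.

(** Change of variables along psi, which multiplies the mass of x by c x. *)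
Lemma integral_bij (G H : T -> R) :
  (forall y, H y = c y * G (psi y)) ->
  (\int[mu]_x (H x)%:E = \int[mu]_x (G x)%:E)%E.
Proof.
move=> HG; rewrite integralE [RHS]integralE.
have pos (f g : T -> \bar R) : (forall x, 0 <= f x)%E -> (forall x, 0 <= g x)%E ->
    (forall y, g y * (mass mu y)%:E = f (psi y) * (mass mu (psi y))%:E)%E ->
    (\int[mu]_x g x = \int[mu]_x f x)%E.
  move=> f0 g0 fg; rewrite !(integral_countable code_inj)//.
  rewrite [RHS](@reindex_esum _ T T setT setT psi); last first.
    split=> // [x y _ _ /(can_inj psiK)//|x _]; by exists (phi x).
  by apply: eq_esum => x _; rewrite !massE fg.
have maxM (r s u : R) : 0 <= s -> Num.max (s * r) 0 * u = Num.max r 0 * (s * u).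
  by move=> s0; rewrite -[X in Num.max _ X](mulr0 s) -maxr_pMr// mulrA [s * _]mulrC.
congr (_ - _)%E; apply: pos => y.
- by rewrite funepos_ge0.
- by rewrite funepos_ge0.
- by rewrite !funeposE HG mass_psi -EFin_max -EFin_max -!EFinM maxM// ltW.
- by rewrite funeneg_ge0.
- by rewrite funeneg_ge0.
- by rewrite !funenegE HG mass_psi -!EFinN -!EFin_max -!EFinM -mulrN maxM// ltW.
Qed.

Let c_psi x : c (psi x) = c x.
Proof. by rewrite -c_phi psiK. Qed.

(** By change of variables the squared norms of f o phi and of c (f o psi) are
    both the integral of c |f|^2, at most the integral of |f|^2 + |c f|^2. *)
Lemma l2_comp (f : T -> R[i]) :
  f \in l2 mu -> (fun x => (c x)%:C * f x) \in l2 mu ->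
  (fun x => f (phi x)) \in l2 mu /\ (fun x => (c x)%:C * f (psi x)) \in l2 mu.
Proof.
rewrite !inE/= => fl cfl.
have cabsc (z : R[i]) (r : R) : cabs (r%:C * z) ^+ 2 = r ^+ 2 * cabs z ^+ 2.
  by rewrite cabs2M cabs2E/= expr0n/= addr0.
have fin : (\int[mu]_x (c x * cabs (f x) ^+ 2)%:E < +oo)%E.
  apply: (@le_lt_trans _ _ (\int[mu]_x ((cabs (f x) ^+ 2)%:E + (cabs ((c x)%:C * f x) ^+ 2)%:E))%E).
    apply: ge0_le_integral => //.
    - by move=> x _; rewrite lee_fin mulr_ge0 ?sqr_ge0// ltW.
    - move=> x _; rewrite -EFinD lee_fin cabsc.
      have := sqr_ge0 (cabs (f x)); have := c_gt0 x; move: (_ ^+ 2) => A c0 A0.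
      rewrite -{2}(mul1r A) -mulrDl ler_wpM2r//.
      have := sqr_ge0 (c x - 1); rewrite sqrrB1 expr2; nra.
  rewrite ge0_integralD//=; try by move=> x _; rewrite lee_fin sqr_ge0.
  by rewrite lte_add_pinfty.
split.
  rewrite -(@integral_bij (fun x => cabs (f (phi x)) ^+ 2) (fun x => c x * cabs (f x) ^+ 2))//.
  by move=> y; rewrite psiK.
rewrite (_ : (\int[mu]_x _ = \int[mu]_x (c x * cabs (f x) ^+ 2)%:E)%E)//.
apply: integral_bij => y; rewrite cabsc c_psi; ring.
Qed.

Lemma L2_inner_adjoint (u v f g : L2 mu) :
  (forall x, v x = u (phi x)) -> (forall x, g x = (c x)%:C * f (psi x)) ->
  L2_inner v f = L2_inner u g.
Proof.
move=> vu gf; rewrite /L2_inner; congr (_ +i* _); congr fine;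
  apply/esym/integral_bij => y; rewrite gf vu psiK;
  by case: (u y) (f (psi y)) => [? ?] [? ?] /=; ring.
Qed.

Lemma indicator_l2 (y : T) : (fun x => (x == y)%:R : R[i]) \in l2 mu.
Proof.
rewrite inE/=.
rewrite (_ : (\int[mu]_x _)%E = (\int[mu]_(x in [set y]) 1)%E); last first.
  rewrite [RHS]integral_mkcond; apply: eq_integral => x _; rewrite /patch.
  case: eqVneq => [->|xy]; first by rewrite mem_set//= cabs2E/= expr0n/= addr0 expr1n.
  by rewrite memNset/= ?cabs2E/= ?expr0n/= ?addr0//; apply/eqP.
by rewrite integral_cst// mul1e massE ltry.
Qed.

Lemma L2_inner_indicator (y : T) (u f : L2 mu) : (forall x, u x = (x == y)%:R) ->
  L2_inner u f = (mass mu y)%:C * (f y)^*.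
Proof.
move=> uE.
have int_ind (F : T -> R) : (forall x, x != y -> F x = 0) ->
    (\int[mu]_x F x)%R = F y * mass mu y.
  move=> F0; rewrite /Rintegral.
  rewrite (_ : (\int[mu]_x _)%E = (\int[mu]_(x in [set y]) (F x)%:E)%E).
    by rewrite integral_point massE -EFinM.
  rewrite [RHS]integral_mkcond; apply: eq_integral => x _; rewrite /patch.
  case: (eqVneq x y) => [->|xy]; first by rewrite mem_set.
  by rewrite memNset/= ?F0//; apply/eqP.
rewrite /L2_inner !int_ind; last 2 first.
- by move=> x xy; rewrite uE (negbTE xy) mul0r.
- by move=> x xy; rewrite uE (negbTE xy) mul0r.
rewrite uE eqxx mul1r; case: (f y) => a b /=.
by apply/eqP; rewrite eq_complex/=; apply/andP; split; apply/eqP; ring.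
Qed.

(** Testing against the indicator of y forces the formula for the adjoint at y,
    and the change of variables gives the converse. *)
Lemma composition_adjoint : op_adjoint (composition_operator mu phi) =
  [set p : L2 mu * L2 mu | forall x, p.2 x = (c x)%:C * p.1 (psi x)].
Proof.
apply/seteqP; split=> [[f g] /= fg y|[f g] /= gf [u v] /= vu]; last first.
  exact: L2_inner_adjoint.
have := fg (MkL2 (indicator_l2 y), MkL2 (indicator_l2 (psi y))).
rewrite /= => H.
have {H} : L2_inner (MkL2 (indicator_l2 (psi y))) f = L2_inner (MkL2 (indicator_l2 y)) g.
  apply: H => x /=; congr (nat_of_bool _)%:R.
  by rewrite -(inj_eq (can_inj phiK)) psiK.
rewrite (@L2_inner_indicator (psi y))// (@L2_inner_indicator y)// mass_psi.
have m0 : (mass mu y)%:C != 0 :> R[i] by rewrite eq_complex/= eqxx andbT gt_eqF// mass_gt0.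
have -> : (c y * mass mu y)%:C * (f (psi y))^* =
    (mass mu y)%:C * ((c y)%:C * (f (psi y))^*) by rewrite rmorphM/=; ring.
move=> /(mulfI m0).
case: (g y) (f (psi y)) => [g1 g2] [f1 f2] /eqP; rewrite eq_complex/= => /andP[/eqP H1 /eqP H2].
by apply/eqP; rewrite eq_complex/=; apply/andP; split; apply/eqP; lra.
Qed.

(** Both products of the operator with its adjoint are multiplication by c, with
    the same domain by [l2_comp]; this uses the invariance of c under phi. *)
Lemma bijective_composition_normal : normal_operator (composition_operator mu phi).
Proof.
have finphi n x : (mu (iter n phi @^-1` [set x]) < +oo)%E.
  rewrite (_ : _ @^-1` _ = [set iter n psi x]) ?massE ?ltry//.
  have iterK : cancel (iter n phi) (iter n psi).
    by elim: n => // n IH y; rewrite iterSr iterS phiK.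
  have iterK' : cancel (iter n psi) (iter n phi).
    by elim: n {iterK} => // n IH y; rewrite iterSr iterS psiK.
  by apply/seteqP; split => y /= => [<-|->].
split.
- exact: composition_is_operator.
- exact: (op_dom_dense code_inj finphi).
- exact: composition_closed.
rewrite composition_adjoint.
apply/seteqP; split=> [[f h] /= [y yf hy]|[f h] /= [y yf hy]].
- have hE x : h x = (c x)%:C * f x by rewrite hy yf psiK.
  have [_ cfl] : (fun x => f (phi x)) \in l2 mu /\ (fun x => (c x)%:C * f (psi x)) \in l2 mu.
    apply: l2_comp; first exact: L2_subproof.
    by rewrite (_ : (fun x => _) = L2_fun h) ?L2_subproof//; apply/funext.
  by exists (MkL2 cfl) => //= x; rewrite hE /= phiK c_phi.
- have hE x : h x = (c x)%:C * f x by rewrite hy yf phiK c_phi.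
  have [fl _] : (fun x => f (phi x)) \in l2 mu /\ (fun x => (c x)%:C * f (psi x)) \in l2 mu.
    apply: l2_comp; first exact: L2_subproof.
    by rewrite (_ : (fun x => _) = L2_fun h) ?L2_subproof//; apply/funext.
  by exists (MkL2 fl) => //= x; rewrite hE /= psiK.
Qed.

End bijective_composition.

Section pullback.
Local Open Scope complex_scope.
Variables (S T : pointedType) (R : realType).
Variables (nu : discreteMeasure S R) (mu : discreteMeasure T R).
Variable code : T -> nat.
Hypothesis code_inj : injective code.
Variable pi : S -> T.
Hypothesis pi_mass : forall x, mu [set x] = nu (pi @^-1` [set x]).

Lemma integral_pullback (f : T -> \bar R) : (forall x, 0 <= f x)%E ->
  (\int[nu]_x f (pi x) = \int[mu]_x f x)%E.
Proof.
move=> f0.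
have mpi : measurable_fun setT (pi : powerset_space S -> powerset_space T) by [].
rewrite -[LHS](@ge0_integral_pushforward _ _ _ _ _ _ mpi nu setT f)//.
by rewrite !(integral_countable code_inj)//; apply: eq_esum => x _; rewrite pi_mass.
Qed.

Lemma pullback_l2 (f : L2 mu) : (fun x => f (pi x)) \in l2 nu.
Proof.
rewrite inE/= (integral_pullback (f := fun x => (cabs (f x) ^+ 2)%:E)); first exact: L2_finite.
by move=> x; rewrite lee_fin sqr_ge0.
Qed.

Definition pullback (f : L2 mu) : L2 nu := MkL2 (pullback_l2 f).

Lemma pullback_linear : linear pullback.
Proof. by move=> a f g; apply: val_inj. Qed.

HB.instance Definition _ := GRing.isLinear.Build R[i] (L2 mu) (L2 nu) *:%R pullback
  pullback_linear.

Lemma pullback_isometry f : `|pullback f| = `|f|.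
Proof.
apply/eqP; rewrite -(@eqrXn2 _ 2)//; try exact: normr_ge0.
rewrite !L2_norm_sqr; apply/eqP; congr ((fine _)%:C).
by apply: (integral_pullback (f := fun x => (cabs (f x) ^+ 2)%:E)) => x; rewrite lee_fin sqr_ge0.
Qed.

(** If pi is measure preserving and intertwines Phi with phi, then composition with
    pi embeds L2 mu isometrically and sends the graph of composition with phi
    into that of composition with Phi. *)
Lemma subnormal_of_factor (phi : T -> T) (Phi : S -> S) :
  (forall n x, (mu (iter n phi @^-1` [set x]) < +oo)%E) ->
  (forall y, pi (Phi y) = phi (pi y)) ->
  normal_operator (composition_operator nu Phi) ->
  subnormal (composition_operator mu phi).
Proof.
move=> finphi pi_Phi normal_Phi; split.
- exact: composition_is_operator.
- exact: (op_dom_dense code_inj finphi).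
exists (L2 nu), pullback, (composition_operator nu Phi).
split=> //; first exact: pullback_isometry.
by move=> f g fg x /=; rewrite fg pi_Phi.
Qed.

End pullback.

(** * The circuit measure *)

Section circuit_measure.
Variables (R : realType) (kappa : nat).
Local Notation a := (trunk_mass R kappa).
Local Notation b := (branch_mass R kappa).
Local Notation phi := (@vertex_map kappa).

Definition vertex_mass (x : vertex kappa) : R :=
  match x with trunk r => a r | branch j => b j end.

Definition vertex_code (x : vertex kappa) : nat :=
  match x with trunk r => (r : nat).*2 | branch j => j.*2.+1 end.

Lemma vertex_code_inj : injective vertex_code.
Proof.
case=> [r|i] [s|j] /= ij; try by exfalso; lia.
  by congr trunk; apply: val_inj => /=; lia.
by congr branch; lia.
Qed.

Lemma vertex_mass_gt0 x : 0 < vertex_mass x.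
Proof. by case: x => [r|j]; [exact: trunk_mass_gt0|exact: branch_mass_gt0]. Qed.

Definition circuit_measure : discreteMeasure (vertex kappa) R :=
  discrete_of_masses vertex_mass_gt0 vertex_code_inj.
Local Notation mu := circuit_measure.

Lemma circuit_measure1 x : mu [set x] = (vertex_mass x)%:E.
Proof. exact: (point_masses1 vertex_mass_gt0). Qed.

Lemma preimage_branch (j : nat) : phi @^-1` [set branch j] = [set branch j.+1].
Proof.
apply/seteqP; split => [[r|[|i]]|_ ->] //=.
by case=> ->.
Qed.

Lemma preimage_trunk (r s : 'I_kappa.+1) : r.+1 = s ->
  phi @^-1` [set trunk r] = [set trunk s].
Proof.
move=> rs; apply/seteqP; split => [[i|[|i]]|_ ->] //=.
- move=> [/(congr1 val)/= H]; congr trunk; apply: val_inj => /=.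
  have := ltn_ord s; have := ltn_ord i; rewrite -rs; move: H.
  case: (nat_of_ord i) => [|k]; first by rewrite add0n/= modn_small//; lia.
  by rewrite addSn/= -addSnnS => + k1 r1; rewrite addSnnS modnDr modn_small; lia.
- by case=> H; have := ltn_ord s; rewrite -rs -H /=; lia.
- congr trunk; apply: val_inj; rewrite /= -rs addSn/= modnDr modn_small//.
Qed.

Lemma preimage_trunk_max :
  phi @^-1` [set trunk ord_max] = [set trunk ord0] `|` [set branch 0].
Proof.
apply/seteqP; split => [[i|[|i]]|_ [->|->]] //=.
- case=> H; left; congr trunk; apply: val_inj => /=.
  move: H; have := ltn_ord i.
  case: (nat_of_ord i) => [//|k] ki; rewrite addSn/= modnDr modn_small; lia.
- by right.
- by congr trunk; apply: val_inj; rewrite /= modn_small.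
Qed.

Lemma iter_preimage n (A : set (vertex kappa)) :
  iter n.+1 phi @^-1` A = iter n phi @^-1` (phi @^-1` A).
Proof. by []. Qed.

Lemma circuit_preimage_branch n j : mu (iter n phi @^-1` [set branch j]) = (b (j + n))%:E.
Proof.
elim: n j => [|n IH] j; first by rewrite addn0; exact: circuit_measure1.
by rewrite iter_preimage preimage_branch IH addSnnS.
Qed.

(** Going back one step raises r by one, except at x_kappa, where the preimages
    x_0 and x_{1,1} contribute a n and b n, with sum a (n + kappa + 1) by the
    definition of the masses of the branch. *)
Lemma circuit_preimage_trunk n (r : 'I_kappa.+1) :
  mu (iter n phi @^-1` [set trunk r]) = (a (n + r))%:E.
Proof.
elim: n r => [|n IH] r; first exact: circuit_measure1.
rewrite iter_preimage; have [rk|rk] := ltnP r kappa.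
  rewrite (@preimage_trunk r (Ordinal (rk : r.+1 < kappa.+1)%N))// IH /=.
  by rewrite addSnnS.
have -> : r = ord_max by apply: val_inj => /=; have := ltn_ord r; lia.
rewrite preimage_trunk_max preimage_setU measureU//; last first.
  by apply/seteqP; split => // y [/= ->].
rewrite [X in (X + _)%E](IH ord0) [X in (_ + X)%E]circuit_preimage_branch -EFinD; congr EFin.
by rewrite /branch_mass add0n addn0 /= addSnnS; ring.
Qed.

Lemma circuit_preimage_fin n x : (mu (iter n phi @^-1` [set x]) < +oo)%E.
Proof.
by case: x => [r|j]; rewrite ?circuit_preimage_trunk ?circuit_preimage_branch ltry.
Qed.

Lemma EFin_div (x y : R) : 0 < y -> (x%:E / y%:E = (x / y)%:E)%E.
Proof. by move=> y0; rewrite inver gt_eqF. Qed.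

Lemma radon_nikodym_trunk :
  radon_nikodym_seq mu phi (trunk ord_max) = trunk_moment R kappa.
Proof.
apply/funext => n; rewrite /radon_nikodym_seq circuit_preimage_trunk circuit_measure1.
by rewrite EFin_div ?trunk_mass_gt0.
Qed.

Lemma radon_nikodym_branch j :
  radon_nikodym_seq mu phi (branch j) = branch_moment R kappa j.
Proof.
apply/funext => n; rewrite /radon_nikodym_seq circuit_preimage_branch circuit_measure1.
by rewrite EFin_div ?branch_mass_gt0.
Qed.

End circuit_measure.

Section loop.
Variable R : realType.
Local Notation kappa := 0%N.
Local Notation a := (trunk_mass R kappa).
Local Notation b := (branch_mass R kappa).
Local Notation phi := (@vertex_map kappa).
Local Notation mu := (circuit_measure R kappa).
Local Notation p := (qratio R kappa).
Local Notation t := (qpoint p).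
Local Notation W := (weight p).
Let p0 : 0 < p := qratio_gt0 R kappa.
Let p1 : p < 1 := qratio_lt1 R kappa.
Let t_gt0 n : 0 < t n := qpoint_gt0 p0 n.
Let W_gt0 n : 0 < W n := weight_gt0 p0 p1 n.
Let a_gt0 s : 0 < a s := trunk_mass_gt0 R kappa s.
Let b_gt0 j : 0 < b j := branch_mass_gt0 R kappa j.

Let evenpos (n : nat) : R := (~~ odd n && (n != 0))%:R.

Lemma has_sum_loop_branch j :
  has_sum (fun n => evenpos n * (W n * t n ^+ j * (t n - 1))) (b j).
Proof.
have -> : b j = a (j.+1 + 0) - a (j + 0) by rewrite /branch_mass addn1 !addn0.
apply: has_sum_eq (has_sumB (@has_sum_even R 0 j.+1) (@has_sum_even R 0 j)) _ => n.
by rewrite /even_term exprS; ring.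
Qed.

(** At x_0 the measure alpha, at x_{1,j+1} the measure t^j (t-1) alpha. *)
Definition loop_weight (x : vertex kappa) (n : nat) : R :=
  match x with
  | trunk _ => evenpos n * W n / a 0%N
  | branch j => evenpos n * (W n * t n ^+ j * (t n - 1)) / b j
  end.

Lemma loop_weight_ge0 x n : 0 <= loop_weight x n.
Proof.
case: x => [_|j] /=; rewrite divr_ge0 ?(ltW (a_gt0 _)) ?(ltW (b_gt0 _))// mulr_ge0//.
  exact: ltW.
by rewrite mulr_ge0 ?subr_ge0 ?qpoint_ge1// mulr_ge0 ?(ltW (W_gt0 _))// exprn_ge0// ltW.
Qed.

Lemma has_sum_loop_weight x : has_sum (loop_weight x) 1.
Proof.
case: x => [r|j].
  have := has_sumZ (c := (a 0%N)^-1) (@has_sum_even R 0 0).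
  rewrite addn0 mulVf ?gt_eqF// => H; apply: has_sum_eq H _ => n.
  by rewrite /even_term /loop_weight /evenpos expr0; ring.
have := has_sumZ (c := (b j)^-1) (@has_sum_loop_branch j).
rewrite mulVf ?gt_eqF// => H; apply: has_sum_eq H _ => n.
by rewrite /loop_weight; ring.
Qed.

Definition loop_probability x : probability R R :=
  atomic_probability t (loop_weight_ge0 x) (@has_sum_loop_weight x).

Lemma on_halfline_loop x : on_halfline (loop_probability x).
Proof.
by apply: on_halfline_atomic => n; [exact: loop_weight_ge0|exact: ltW].
Qed.

Lemma loop_probabilityE x A :
  loop_probability x A = (\sum_(n <oo) (loop_weight x n)%:E * \d_(t n) A)%E.
Proof. by apply: atomicE; exact: loop_weight_ge0. Qed.

Lemma integral_loop x A : measurable A ->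
  (\int[loop_probability x]_(s in A) s%:E =
   \sum_(n <oo) (loop_weight x n)%:E * (\d_(t n) A * (t n)%:E))%E.
Proof.
move=> mA; apply: integral_atomic => //; first exact: loop_weight_ge0.
by move=> n; rewrite lee_fin ltW.
Qed.

(** At x_0 the condition says that alpha + (t-1) alpha = t alpha, and on the
    branch that t^(j+1) (t-1) alpha = t (t^j (t-1) alpha). *)
Lemma loop_consistency : consistency_condition mu phi loop_probability.
Proof.
move=> x A _ mA _; rewrite integral_loop//.
have dirac_ge0 n : (0 <= \d_(t n) A :> \bar R)%E by [].
have lw0 y n : (0 <= (loop_weight y n)%:E * \d_(t n) A)%E.
  by rewrite mule_ge0// lee_fin loop_weight_ge0.
case: x => [r|j].
  have -> : r = ord_max by apply: val_inj => /=; have := ltn_ord r; lia.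
  rewrite preimage_trunk_max (esumID [set trunk ord0]); last first.
    by move=> y _; rewrite mule_ge0.
  rewrite (_ : _ `&` [set _] = [set trunk ord0]); last first.
    by apply/seteqP; split => [y []//|y ->]; split => //; left.
  rewrite (_ : _ `&` ~` _ = [set branch 0]); last first.
    apply/seteqP; split => [y [[]//]|y ->]; split => //; by [right|].
  rewrite !esum_set1 ?mule_ge0// !circuit_measure1 /= !loop_probabilityE.
  rewrite -!nneseriesZl//; try by move=> n _; exact: lw0.
  rewrite -nneseriesD; last 2 first.
  - by move=> n _ _; rewrite mule_ge0// lee_fin ltW.
  - by move=> n _ _; rewrite mule_ge0// lee_fin ltW.
  rewrite inver gt_eqF// -nneseriesZl; last first.
    by move=> n _; rewrite adde_ge0// mule_ge0// lee_fin ltW.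
  apply: eq_eseriesr => n _; rewrite !diracE -!EFinM; congr EFin.
  rewrite /loop_weight expr0; have a0 := lt0r_neq0 (a_gt0 0); have b0 := lt0r_neq0 (b_gt0 0).
  by field; rewrite a0 b0.
rewrite preimage_branch esum_set1 ?mule_ge0// !circuit_measure1 /= loop_probabilityE.
rewrite -nneseriesZl; last by move=> n _; exact: lw0.
rewrite inver gt_eqF// -nneseriesZl; last by move=> n _; rewrite mule_ge0// lee_fin ltW.
apply: eq_eseriesr => n _; rewrite !diracE -!EFinM; congr EFin.
have b0 := lt0r_neq0 (b_gt0 j); have b1 := lt0r_neq0 (b_gt0 j.+1).
by rewrite /loop_weight exprS; field; rewrite b0 b1.
Qed.

End loop.

(** * Subnormality over a loop *)

Section natural_extension.
Variable R : realType.
Local Notation a := (trunk_mass R 0).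
Local Notation b := (branch_mass R 0).
Local Notation phi := (@vertex_map 0).
Local Notation mu := (circuit_measure R 0).
Local Notation p := (qratio R 0).
Local Notation W := (weight p).
Let p0 : 0 < p := qratio_gt0 R 0.
Let p1 : p < 1 := qratio_lt1 R 0.
Local Notation T k := (qpoint p k.+1.*2).
Let T_gt0 k : 0 < T k := qpoint_gt0 p0 _.
Let T_gt1 k : 1 < T k. Proof. by rewrite doubleS qpoint_gt1. Qed.
Let T_neq0 k : T k != 0. Proof. by rewrite gt_eqF. Qed.
Let W_gt0 n : 0 < W n := weight_gt0 p0 p1 n.

(** A point (true, j, k) is the integer j, and (false, i, k) the integer -(i+1),
    over the atom t_(2k+2) of alpha. *)
Definition ext_space : Type := (bool * nat * nat)%type.
HB.instance Definition _ := Pointed.on ext_space.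

(** The mass of the integer m over t is alpha({t}) (t-1) t^m. *)
Definition ext_mass (y : ext_space) : R :=
  match y with
  | (true, j, k) => W k.+1.*2 * (T k - 1) * T k ^+ j
  | (false, i, k) => W k.+1.*2 * (T k - 1) / T k ^+ i.+1
  end.

Lemma ext_mass_gt0 y : 0 < ext_mass y.
Proof.
case: y => [[[] j] k] /=; first by rewrite mulr_gt0 ?exprn_gt0// mulr_gt0 ?subr_gt0.
by rewrite divr_gt0 ?exprn_gt0// mulr_gt0 ?subr_gt0.
Qed.

Definition ext_code (y : ext_space) : nat := pickle (y : bool * nat * nat).

Lemma ext_code_inj : injective ext_code.
Proof. exact: (pcan_inj pickleK). Qed.

Definition ext_measure : discreteMeasure ext_space R :=
  discrete_of_masses ext_mass_gt0 ext_code_inj.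

Definition ext_map (y : ext_space) : ext_space :=
  match y with
  | (true, j.+1, k) => (true, j, k)
  | (true, 0%N, k) => (false, 0%N, k)
  | (false, i, k) => (false, i.+1, k)
  end.

Definition ext_inv (y : ext_space) : ext_space :=
  match y with
  | (true, j, k) => (true, j.+1, k)
  | (false, 0%N, k) => (true, 0%N, k)
  | (false, i.+1, k) => (false, i, k)
  end.

Lemma ext_mapK : cancel ext_map ext_inv.
Proof. by case=> [[[] [|j]] k]. Qed.

Lemma ext_invK : cancel ext_inv ext_map.
Proof. by case=> [[[] [|j]] k]. Qed.

Lemma ext_mass_inv y : mass ext_measure (ext_inv y) = T y.2 * mass ext_measure y.
Proof.
have massE x : mass ext_measure x = ext_mass x.
  exact: (congr1 fine (point_masses1 ext_mass_gt0 x)).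
rewrite !massE; case: y => [[[] [|j]] k] /=.
- by rewrite expr1 expr0 mulr1 mulrC.
- by rewrite [in LHS]exprS; ring.
- by rewrite expr0 expr1 mulr1; field; exact: T_neq0.
- by rewrite [in RHS]exprS; field; rewrite expf_neq0 ?T_neq0.
Qed.

Lemma ext_normal : normal_operator (composition_operator ext_measure ext_map).
Proof.
apply: (bijective_composition_normal ext_code_inj ext_mapK ext_invK ext_mass_inv).
by case=> [[[] [|j]] k].
Qed.

Definition ext_proj (y : ext_space) : vertex 0 :=
  match y with
  | (true, j, _) => branch j
  | (false, _, _) => trunk ord0
  end.

Lemma ext_proj_map y : ext_proj (ext_map y) = phi (ext_proj y).
Proof.
have trunk0 (r s : 'I_1) : trunk r = trunk s :> vertex 0 by rewrite (ord1 r) (ord1 s).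
by case: y => [[[] [|j]] k] //=; exact: trunk0.
Qed.

(** Sums over the atoms of alpha, reindexed by k with n = 2k+2. *)
Lemma esum_even (f : nat -> R) (l : R) : (forall n, 0 <= f n) ->
  has_sum (fun n => (~~ odd n && (n != 0%N))%:R * f n) l ->
  (\esum_(k in [set: nat]) (f k.+1.*2)%:E = l%:E)%E.
Proof.
move=> f0 fl; rewrite -(has_sum_nneseries _ fl); last by move=> n; rewrite mulr_ge0.
rewrite nneseries_esumT; last by move=> n; rewrite lee_fin mulr_ge0.
rewrite -(@reindex_esum R nat nat setT [set n | ~~ odd n && (n != 0%N)]
  (fun k => k.+1.*2) (fun n => (f n)%:E)).
  rewrite esum_mkcond; apply: eq_esum => n _.
  case: ifPn; first by rewrite inE/= => ->; rewrite mul1r.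
  by rewrite notin_setE/= => /negP/negbTE ->; rewrite mul0r.
split=> [k _|k l' _ _|n] /=; first by rewrite odd_double.
  by move=> /double_inj [].
by move=> /andP[en n0]; exists (n./2.-1) => //; lia.
Qed.

(** The unrolled loop over the atom t has mass sum_i (t-1) t^(-i-1) = 1, times the
    mass of alpha at t. *)
Lemma geometric_fiber k :
  (\esum_(i in [set: nat]) (W k.+1.*2 * (T k - 1) / T k ^+ i.+1)%:E = (W k.+1.*2)%:E)%E.
Proof.
have term_ge0 i : 0 <= W k.+1.*2 * (T k - 1) / T k ^+ i.+1.
  by rewrite ltW// divr_gt0 ?exprn_gt0// mulr_gt0 ?subr_gt0.
rewrite -nneseries_esumT; last by move=> i; rewrite lee_fin.
apply: has_sum_nneseries => //.
have Tinv : 0 <= (T k)^-1 < 1 by rewrite invr_ge0 ltW//= invf_lt1.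
have := has_sumZ (c := W k.+1.*2 * (T k - 1) / T k) (has_sum_geometric Tinv).
have -> : W k.+1.*2 * (T k - 1) / T k * (1 - (T k)^-1)^-1 = W k.+1.*2.
  have T1 : T k - 1 != 0 by rewrite subr_eq0 gt_eqF.
  by field; rewrite T1 T_neq0.
move=> H; apply: has_sum_eq H _ => i.
by rewrite exprVn exprS invfM; ring.
Qed.

(** On the branch both sides are the moment of order j of (t-1) alpha, which is
    also that of nu; at x_0 both sides are the total mass of alpha, by
    [geometric_fiber]. *)
Lemma ext_proj_mass x : mu [set x] = ext_measure (ext_proj @^-1` [set x]).
Proof.
rewrite circuit_measure1 [RHS]/(point_masses ext_mass (ext_proj @^-1` [set x])) /point_masses.
under eq_esum do rewrite (gtr0_norm (ext_mass_gt0 _)).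
case: x => [r|j].
  rewrite (_ : ext_proj @^-1` [set trunk r] =
    \bigcup_(k in [set: nat]) [set y : ext_space | ~~ y.1.1 /\ y.2 = k]); last first.
    apply/seteqP; split => [[[[] i] k] //= _|[[[] i] k] /= [k' _ [//]]].
    - by exists k.
    - by move=> _ _; rewrite (ord1 r).
  rewrite esum_bigcupT; last 2 first.
  - by move=> k l _ _ [y [[_ <-] [_ <-]]].
  - by move=> y; rewrite lee_fin ltW// ext_mass_gt0.
  transitivity (\esum_(k in [set: nat]) (W k.+1.*2)%:E)%E.
    rewrite /= (ord1 r); apply/esym/esum_even; first by move=> n; exact: ltW.
    have := @has_sum_even R 0 0; rewrite addn0 => H; apply: has_sum_eq H _ => n.
    by rewrite /even_term expr0 mulr1.
  apply: eq_esum => k _; rewrite -geometric_fiber.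
  apply/esym; apply: (@reindex_esum R nat ext_space setT _ (fun i => (false, i, k))).
  split=> [i _ //|i i' _ _ [] //|[[[] i] k'] /= [//_ ->]]; by exists i.
rewrite (@reindex_esum R nat ext_space setT _ (fun k => (true, j, k))); last first.
  split=> [i _ //|i i' _ _ [] //|[[[] i] k'] //= [->]]; by exists k'.
apply/esym; apply: (@esum_even (fun n => W n * (qpoint p n - 1) * qpoint p n ^+ j)).
  by move=> n; rewrite mulr_ge0 ?exprn_ge0 ?(ltW (qpoint_gt0 p0 _))// mulr_ge0 ?(ltW (W_gt0 _))//
    subr_ge0 qpoint_ge1.
apply: has_sum_eq (@has_sum_loop_branch R j) _ => n; ring.
Qed.

Lemma loop_subnormal : subnormal (composition_operator mu phi).
Proof.
apply: (subnormal_of_factor (@vertex_code_inj 0) ext_proj_mass _ ext_proj_map ext_normal).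
exact: circuit_preimage_fin.
Qed.

End natural_extension.

Local Open Scope classical_set_scope.
Local Open Scope ereal_scope.

Theorem theorem5p4p2 (R : realType) (kappa : nat) :
  exists mu : discreteMeasure (vertex kappa) R,
    let phi := @vertex_map kappa in
    let C_phi := composition_operator mu phi in
    let h := radon_nikodym_seq mu phi in
    let x (r : 'I_kappa.+1) : vertex kappa := trunk r in
    let x11 : vertex kappa := branch 0 in
    [/\ dense (op_dom_infty C_phi),
        (* (i) *)
        [/\ stieltjes_moment_seq (h (x ord_max)),
            H_determinate (h (x ord_max)) &
            has_H_index 0%R (h (x ord_max)) 0],
        (* (ii) *)
        (forall j : nat, S_indeterminate (h (branch j))) /\
        stieltjes_moment_seq (h x11),
        (* (iii) *)
        exists P : probability R R,
          [/\ on_halfline P,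
              S_representing (h x11) P /\ P `[0%R, 1%R] = 0,
              forall r : 'I_kappa.+1, (0 < r)%N ->
                mu [set x11] / mu [set x r] *
                  (\int[P]_(t in `[0%R, +oo[)
                    ((t ^+ r - 1) / (t ^+ kappa.+1 - 1))%:E) +
                mu [set x ord0] / mu [set x r] = 1,
              mu [set x11] *
                (\int[P]_(t in `[0%R, +oo[) ((t ^+ kappa.+1 - 1)^-1)%:E) < +oo &
              ~ (mu [set x11] / mu [set x ord0] *
                  (\int[P]_(t in `[0%R, +oo[) ((t ^+ kappa.+1 - 1)^-1)%:E)
                <= 1)] &
        (* (iv) *)
        kappa = 0%N ->
          (exists P' : vertex kappa -> probability R R,
            (forall y, on_halfline (P' y)) /\
            consistency_condition mu phi P') /\
          subnormal C_phi].
Proof.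
exists (circuit_measure R kappa) => phi C_phi h x x11.
have h_trunk : h (x ord_max) = trunk_moment R kappa by exact: radon_nikodym_trunk.
have h_branch j : h (branch j) = branch_moment R kappa j by exact: radon_nikodym_branch.
have mu1 y : circuit_measure R kappa [set y] = (vertex_mass R y)%:E by exact: circuit_measure1.
have a_gt0 s : (0 < trunk_mass R kappa s)%R by exact: trunk_mass_gt0.
have b_gt0 j : (0 < branch_mass R kappa j)%R by exact: branch_mass_gt0.
split.
- exact: (op_dom_infty_dense (@vertex_code_inj kappa) (@circuit_preimage_fin R kappa)).
- rewrite h_trunk; split.
  + exists (atomic (qpoint (qratio R kappa)) (alpha_weight R kappa)).
    split; first exact: H_representing_alpha.
    by apply: on_halfline_atomic; [exact: alpha_weight_ge0|exact: qpoint_ge0].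
  + exact: H_determinate_alpha.
  + split; first exact: H_determinate_alpha.
    by exists (atomic (qpoint (qratio R kappa)) (alpha_weight R kappa));
      [exact: H_representing_alpha|exact: H_index_alpha].
- split=> [j|]; first by rewrite h_branch; exact: S_indeterminate_branch.
  by rewrite h_branch; have [] := S_indeterminate_branch R kappa 0.
- exists (branch_probability R kappa).
  have [H_rep half] := S_representing_branch R kappa 0.
  split.
  + exact: half.
  + by split; [rewrite h_branch; split|exact: branch_probability01].
  + move=> r _; rewrite integral_branch_probability !mu1 /= !EFin_div// -EFinM -EFinD.
    congr EFin; have ar := lt0r_neq0 (a_gt0 r); have b0 := lt0r_neq0 (b_gt0 0%N).
    by field; rewrite ar b0.
  + by rewrite integral_branch_probability_inv mu1 -EFinM ltry.
  + rewrite integral_branch_probability_inv !mu1 /= EFin_div// -EFinM lee_fin.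
    apply/negP; rewrite -ltNge.
    have a0 := lt0r_neq0 (a_gt0 0%N); have b0 := lt0r_neq0 (b_gt0 0%N).
    rewrite (_ : (_ * _ = 1 + (trunk_mass R kappa 0)^-1)%R); last by field; rewrite a0 b0.
    by rewrite ltrDl invr_gt0.
move=> k0; move: @phi @C_phi {h x x11 h_trunk h_branch mu1 a_gt0 b_gt0}; rewrite k0 => phi C_phi.
split; last exact: loop_subnormal.
exists (@loop_probability R); split; first exact: on_halfline_loop.
exact: loop_consistency.
Qed.
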